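(* For every $n\ge 1$, the group $G_n=\mathrm{Aut}_{K\text{-alg}}(\mathbb{S}_n)$ is the iterated semidirect product $$G_n = S_n\ltimes \mathbb{T}^n\ltimes \mathrm{Inn}(\mathbb{S}_n)$$ (meaning $S_n\ltimes(\mathbb{T}^n\ltimes\mathrm{Inn}(\mathbb{S}_n))$): $\mathrm{Inn}(\mathbb{S}_n)$ and $\mathbb{T}^n\ltimes\mathrm{Inn}(\mathbb{S}_n)$ are normal subgroups of $G_n$, and every $\sigma\in G_n$ can be written uniquely as $\sigma=\tau\, t_\lambda\, \omega$ with $\tau\in S_n$, $t_\lambda\in\mathbb{T}^n$, $\omega\in \mathrm{Inn}(\mathbb{S}_n)$.
   Context: $K$ is a field of characteristic zero and $n\ge1$. $\mathbb{S}_n$ is the $K$-algebra generated by $x_1,\dots,x_n,y_1,\dots,y_n$ subject to the defining relations $y_1x_1=\cdots=y_nx_n=1$ and $[x_i,y_j]=[x_i,x_j]=[y_i,y_j]=0$ for all $i\ne j$ (where $[a,b]=ab-ba$). $G_n:=\mathrm{Aut}_{K\text{-alg}}(\mathbb{S}_n)$. The torus $\mathbb{T}^n=\{t_\lambda\mid \lambda=(\lambda_1,\dots,\lambda_n)\in (K^* )^n\}$ consists of the automorphisms $t_\lambda(x_i)=\lambda_ix_i$, $t_\lambda(y_i)=\lambda_i^{-1}y_i$. The symmetric group $S_n$ is identified with the automorphisms $\tau(x_i)=x_{\tau(i)}$, $\tau(y_i)=y_{\tau(i)}$. $\mathbb{S}_n^*$ is the group of units of $\mathbb{S}_n$, and $\mathrm{Inn}(\mathbb{S}_n)=\{\omega_u: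 a\mapsto uau^{-1}\mid u\in\mathbb{S}_n^*\}$ is the group of inner automorphisms. *)

(* Defs.v *)
From HB Require Import structures.
From mathcomp Require Import all_boot all_fingroup all_order all_algebra.
Set Implicit Arguments. Unset Strict Implicit. Unset Printing Implicit Defensive.
Import Order.TTheory GRing.Theory Num.Theory.
Local Open Scope ring_scope.

Definition S_relations (K : fieldType) (n : nat) (B : algType K)
    (x y : 'I_n -> B) : Prop :=
  (forall i, y i * x i = 1) /\
  (forall i j, i != j ->
     [/\ x i * y j = y j * x i, x i * x j = x j * x i & y i * y j = y j * y i]).

Definition is_Kalg_hom (K : fieldType) (A B : algType K) (f : A -> B) : Prop :=
  [/\ forall (a : K) (u v : A), f (a *: u + v) = a *: f u + f v,
      forall u v : A, f (u * v) = f u * f v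
    & f 1 = 1].

(* A (with x, y) is THE K-algebra generated by x_i, y_i subject to the
   defining relations, i.e. it satisfies the relations and is initial. *)
Definition is_S_presentation (K : fieldType) (n : nat) (A : algType K)
    (x y : 'I_n -> A) : Prop :=
  S_relations x y /\
  forall (B : algType K) (xb yb : 'I_n -> B), S_relations xb yb ->
    (exists f : A -> B, is_Kalg_hom f /\
        forall i, f (x i) = xb i /\ f (y i) = yb i) /\
    (forall f g : A -> B, is_Kalg_hom f -> is_Kalg_hom g ->
        (forall i, f (x i) = g (x i) /\ f (y i) = g (y i)) ->
        forall a, f a = g a).

Definition is_Kalg_aut (K : fieldType) (A : algType K) (f : A -> A) : Prop :=
  is_Kalg_hom f /\ bijective f.

Definition is_perm_aut (K : fieldType) (n : nat) (A : algType K)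
    (x y : 'I_n -> A) (f : A -> A) : Prop :=
  is_Kalg_aut f /\ exists tau : 'S_n,
    forall i, f (x i) = x (tau i) /\ f (y i) = y (tau i).

Definition is_torus_aut (K : fieldType) (n : nat) (A : algType K)
    (x y : 'I_n -> A) (f : A -> A) : Prop :=
  is_Kalg_aut f /\ exists lambda : 'I_n -> K, (forall i, lambda i != 0) /\
    forall i, f (x i) = lambda i *: x i /\ f (y i) = (lambda i)^-1 *: y i.

Definition is_inner_aut (K : fieldType) (A : algType K) (f : A -> A) : Prop :=
  exists u v : A, [/\ u * v = 1, v * u = 1 & forall a, f a = u * a * v].

Definition is_torus_inner_aut (K : fieldType) (n : nat) (A : algType K)
    (x y : 'I_n -> A) (f : A -> A) : Prop :=
  exists t w : A -> A, [/\ is_torus_aut x y t, is_inner_aut w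
                         & forall a, f a = t (w a)].

(* H (a predicate on maps A -> A) is a normal subgroup of G_n
   (group law = composition, equality = pointwise equality). *)
Definition is_normal_subgroup_aut (K : fieldType) (A : algType K)
    (H : (A -> A) -> Prop) : Prop :=
  [/\ (forall h, H h -> is_Kalg_aut h),
      (forall h h', (forall a, h a = h' a) -> H h -> H h') /\ H id,
      (forall h g, H h -> H g -> H (h \o g)),
      (forall h h', H h -> (forall a, h (h' a) = a /\ h' (h a) = a) -> H h')
    & (forall g g' h, is_Kalg_aut g ->
         (forall a, g (g' a) = a /\ g' (g a) = a) -> H h ->
         H (g \o h \o g'))].

(* Main.v *)
Require Import Defs.
From HB Require Import structures.
From mathcomp Require Import all_boot all_fingroup all_order all_algebra.
From mathcomp Require Import boolp ssrcomplements mpoly.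
Set Implicit Arguments. Unset Strict Implicit. Unset Printing Implicit Defensive.
Import Order.TTheory GRing.Theory.
Local Open Scope ring_scope.

(* The algebra acts faithfully on [P = K[X_1, ..., X_n]], [x_i] by
   multiplication by [X_i] and [y_i] by lowering the exponent of [X_i]. Since
   [P] is isomorphic to a minimal left ideal, an automorphism [sigma] is
   conjugation by some linear bijection [phi] of [P]. The ideals [p_j] of elements killed on the
   right by a power of [x_j] are prime, with minimal intersection, so each [p_j]
   contains [sigma p_i] for some [i]; as [x_i] is central and invertible modulo
   [p_i], this forces [sigma (x_i) x_j ^ r = c x_j ^ (r + k)] with [c != 0], and
   comparison with the inverse of [sigma] gives [k = 1] and [i |-> j] bijective.
   Up to a permutation and a torus element, [(sigma (x_i) - x_i) x_i ^ r = 0]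
   for all [i], and the same holds for the inverse of [sigma]. Hence
   [[phi, x_i] x_i ^ r = 0], which characterizes the operators coming from the
   algebra: [phi] is a unit and [sigma] is inner. Normality and uniqueness are
   read off the characters [A -> K], on which inner automorphisms act
   trivially. *)

(** * Linear operators on polynomials *)

Section Endomorphisms.

Variables (K : fieldType) (n : nat).
Local Notation P := {mpoly K[n]}.

Record endo := Endo { endo_fun :> P -> P; endo_linear : linear endo_fun }.

HB.instance Definition _ := gen_eqMixin endo.
HB.instance Definition _ := gen_choiceMixin endo.

Lemma endoP (f g : endo) : f =1 g -> f = g.
Proof.
case: f g => [f fL] [g gL] /= /funext fg; case: _ / fg gL => gL.
by congr Endo; apply: Prop_irrelevance.
Qed.

Lemma endoD (f : endo) : {morph f : p q / p + q}.
Proof. by move=> p q; have := endo_linear f 1 p q; rewrite !scale1r. Qed.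

Lemma endo0 (f : endo) : f 0 = 0.
Proof. by apply: (addrI (f 0)); rewrite -endoD !addr0. Qed.

Lemma endoZ (f : endo) c p : f (c *: p) = c *: f p.
Proof. by have := endo_linear f c p 0; rewrite endo0 !addr0. Qed.

Fact endo_zero_linear : linear (fun _ : P => 0 : P).
Proof. by move=> c p q; rewrite scaler0 addr0. Qed.

Fact endo_opp_linear (f : endo) : linear (fun p => - f p).
Proof. by move=> c p q; rewrite endo_linear opprD scalerN. Qed.

Fact endo_add_linear (f g : endo) : linear (fun p => f p + g p).
Proof. by move=> c p q; rewrite !endo_linear scalerDr addrACA. Qed.

Fact endo_scale_linear (a : K) (f : endo) : linear (fun p => a *: f p).
Proof. by move=> c p q; rewrite endo_linear scalerDr !scalerA mulrC. Qed.

Fact endo_one_linear : linear (fun p : P => p).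
Proof. by []. Qed.

Fact endo_mul_linear (f g : endo) : linear (fun p => f (g p)).
Proof. by move=> c p q; rewrite !endo_linear. Qed.

Fact endo_addA : associative (fun f g => Endo (endo_add_linear f g)).
Proof. by move=> f g h; apply: endoP => p; apply: addrA. Qed.

Fact endo_addC : commutative (fun f g => Endo (endo_add_linear f g)).
Proof. by move=> f g; apply: endoP => p; apply: addrC. Qed.

Fact endo_add0 :
  left_id (Endo endo_zero_linear) (fun f g => Endo (endo_add_linear f g)).
Proof. by move=> f; apply: endoP => p; apply: add0r. Qed.

Fact endo_addN : left_inverse (Endo endo_zero_linear)
  (fun f => Endo (endo_opp_linear f)) (fun f g => Endo (endo_add_linear f g)).
Proof. by move=> f; apply: endoP => p; apply: addNr. Qed.

HB.instance Definition _ :=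
  GRing.isZmodule.Build endo endo_addA endo_addC endo_add0 endo_addN.

Fact endo_mulA : associative (fun f g => Endo (endo_mul_linear f g)).
Proof. by move=> f g h; apply: endoP. Qed.

Fact endo_mul1 :
  left_id (Endo endo_one_linear) (fun f g => Endo (endo_mul_linear f g)).
Proof. by move=> f; apply: endoP. Qed.

Fact endo_mulr1 :
  right_id (Endo endo_one_linear) (fun f g => Endo (endo_mul_linear f g)).
Proof. by move=> f; apply: endoP. Qed.

Fact endo_mulDl :
  left_distributive (fun f g => Endo (endo_mul_linear f g)) +%R.
Proof. by move=> f g h; apply: endoP. Qed.

Fact endo_mulDr :
  right_distributive (fun f g => Endo (endo_mul_linear f g)) +%R.
Proof. by move=> f g h; apply: endoP => p; apply: endoD. Qed.

Fact endo_one_neq0 : Endo endo_one_linear != 0.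
Proof.
apply/eqP => /(congr1 (fun f : endo => f 1)) /= /eqP.
by rewrite oner_eq0.
Qed.

HB.instance Definition _ := GRing.Zmodule_isNzRing.Build endo
  endo_mulA endo_mul1 endo_mulr1 endo_mulDl endo_mulDr endo_one_neq0.

Fact endo_scaleA a b (f : endo) :
  Endo (endo_scale_linear a (Endo (endo_scale_linear b f))) =
  Endo (endo_scale_linear (a * b) f).
Proof. by apply: endoP => p; apply: scalerA. Qed.

Fact endo_scale1 : left_id 1 (fun a f => Endo (endo_scale_linear a f)).
Proof. by move=> f; apply: endoP => p; apply: scale1r. Qed.

Fact endo_scaleDr :
  right_distributive (fun a f => Endo (endo_scale_linear a f)) +%R.
Proof. by move=> a f g; apply: endoP => p; apply: scalerDr. Qed.

Fact endo_scaleDl f :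
  {morph (fun a => Endo (endo_scale_linear a f)) : a b / a + b}.
Proof. by move=> a b; apply: endoP => p; apply: scalerDl. Qed.

HB.instance Definition _ := GRing.Zmodule_isLmodule.Build K endo
  endo_scaleA endo_scale1 endo_scaleDr endo_scaleDl.

Fact endo_scaleAl (a : K) (f g : endo) : a *: (f * g) = (a *: f) * g.
Proof. by apply: endoP. Qed.

HB.instance Definition _ := GRing.Lmodule_isLalgebra.Build K endo endo_scaleAl.

Fact endo_scaleAr (a : K) (f g : endo) : a *: (f * g) = f * (a *: g).
Proof. by apply: endoP => p; rewrite /= endoZ. Qed.

HB.instance Definition _ := GRing.Lalgebra_isAlgebra.Build K endo endo_scaleAr.

Lemma endoME (f g : endo) p : (f * g) p = f (g p).
Proof. by []. Qed.

Lemma endoDE (f g : endo) p : (f + g) p = f p + g p.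
Proof. by []. Qed.

Lemma endoBE (f g : endo) p : (f - g) p = f p - g p.
Proof. by []. Qed.

Lemma endo0E p : (0 : endo) p = 0.
Proof. by []. Qed.

Lemma endoZE c (f : endo) p : (c *: f) p = c *: f p.
Proof. by []. Qed.

End Endomorphisms.

(** * Linear extension from monomials *)

Section LinearExtension.

Variables (K : fieldType) (n : nat) (W : lmodType K).
Local Notation P := {mpoly K[n]}.
Implicit Types (p : P) (m : 'X_{1..n}).

Definition lext (g : 'X_{1..n} -> W) p := \sum_(m <- msupp p) p@_m *: g m.

(** The support varies with [p]; summing over all monomials of degree below [k] gives several
    polynomials a common index set, which is what the proof of linearity needs. *)
Lemma lextwE g p k :
  (msize p <= k)%N -> lext g p = \sum_(m : 'X_{1..n < k}) p@_m *: g m.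
Proof.
move=> le_pk; pose I : subFinType _ := 'X_{1..n < k}.
rewrite /lext (big_mksub I) ?msupp_uniq //=; last first.
  by move=> m /msize_mdeg_lt /leq_trans; apply.
by rewrite big_rmcond //= => m /memN_msupp_eq0 ->; rewrite scale0r.
Qed.

Lemma lext_linear g : linear (lext g).
Proof.
move=> c p q; pose k := maxn (msize (c *: p + q)) (maxn (msize p) (msize q)).
rewrite !(@lextwE g _ k) ?leq_max ?leqnn ?orbT // scaler_sumr -big_split /=.
by apply: eq_bigr => m _; rewrite mcoeffD mcoeffZ scalerDl scalerA.
Qed.

Lemma lextX g m : lext g 'X_[m] = g m.
Proof. by rewrite /lext msuppX big_seq1 mcoeffX eqxx scale1r. Qed.

Lemma linear_monP (f g : P -> W) :
  linear f -> linear g -> (forall m, f 'X_[m] = g 'X_[m]) -> f =1 g.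
Proof.
move=> fL gL fg; elim/mpolyind => [|c m p _ _ IHp].
  (* Linearity with scalar [-1] at zero arguments yields [f 0 = 0] and [g 0 = 0]. *)
  by have := fL (-1) 0 0; have := gL (-1) 0 0;
    rewrite !scaleN1r !addNr => -> ->.
by rewrite fL gL fg IHp.
Qed.

End LinearExtension.

(** * Raising and lowering operators *)

Section ShiftOperators.

Variables (K : fieldType) (n : nat).
Local Notation P := {mpoly K[n]}.
Implicit Types (i j : 'I_n) (p q : P) (m : 'X_{1..n}).

Definition endo_lext (g : 'X_{1..n} -> P) : endo K n := Endo (lext_linear g).

Lemma endo_monP (f g : endo K n) : (forall m, f 'X_[m] = g 'X_[m]) -> f = g.
Proof. by move=> fg; apply/endoP/linear_monP => //; apply: endo_linear. Qed.

(** Subtraction of exponents is truncated, hence the explicit zero when [X_i] does not occur. *)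
Definition lower_mon i m : P := if m i == 0%N then 0 else 'X_[m - U_(i)].

Definition lower i : endo K n := endo_lext (lower_mon i).

Fact mulX_linear i : linear (fun p => 'X_i * p : P).
Proof. by move=> c p q; rewrite mulrDr scalerAr. Qed.

Definition raise i : endo K n := Endo (@mulX_linear i).

Lemma lowerX i m : lower i 'X_[m] = lower_mon i m.
Proof. exact: lextX. Qed.

Lemma raiseX i m : raise i 'X_[m] = 'X_[U_(i) + m].
Proof. by rewrite /= mpolyXD. Qed.

Lemma lower_raise i : lower i * raise i = 1.
Proof.
apply: endo_monP => m; rewrite endoME raiseX lowerX /lower_mon mnmDE.
rewrite mnm1E eqxx addnC addn1 /=; congr 'X_[_].
by apply/mnmP => k; rewrite mnmBE mnmDE addKn.
Qed.

Lemma raiseC i j : raise i * raise j = raise j * raise i.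
Proof. by apply: endoP => p /=; rewrite mulrCA. Qed.

Lemma raise_lower i j :
  i != j -> raise i * lower j = lower j * raise i.
Proof.
move=> nij; apply: endo_monP => m.
rewrite !endoME raiseX !lowerX /lower_mon mnmDE mnm1E (negPf nij) add0n.
case: eqP => [_|/eqP mj]; first by rewrite endo0.
rewrite raiseX; congr 'X_[_]; apply/mnmP => k.
rewrite !(mnmBE, mnmDE, mnm1E) addnBA //.
by case: eqP => // <-; rewrite lt0n.
Qed.

Lemma lowerC i j : lower i * lower j = lower j * lower i.
Proof.
have [->//|nij] := eqVneq i j.
have lower_off k l m : k != l -> lower_mon k (m - U_(l)) =
    if m k == 0%N then 0 else 'X_[m - U_(l) - U_(k)].
  move=> nkl.
  by rewrite /lower_mon mnmBE mnm1E [l == k]eq_sym (negPf nkl) subn0.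
apply: endo_monP => m; rewrite !endoME !lowerX /lower_mon.
case: ifP => mj; case: ifP => mi; rewrite ?endo0 ?lowerX ?lower_off ?mi ?mj //.
- by rewrite eq_sym.
- by congr 'X_[_]; apply/mnmP => k; rewrite !mnmBE subnAC.
- by rewrite eq_sym.
Qed.

Lemma shift_relations : S_relations raise lower.
Proof.
split=> [i|i j nij]; first exact: lower_raise.
by split; [apply: raise_lower|apply: raiseC|apply: lowerC].
Qed.

(** Taking a coefficient is linear with values in [K^o], so monomials suffice. This form is free of
    the case distinction and iterates to powers of the [y_i]. *)
Lemma mcoeff_lower i p m : (lower i p)@_m = p@_(U_(i) + m).
Proof.
have L1 : linear (fun p => (lower i p)@_m : K^o).
  by move=> c u v; rewrite endo_linear mcoeffD mcoeffZ.
have L2 : linear (fun p => p@_(U_(i) + m) : K^o).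
  by move=> c u v; rewrite mcoeffD mcoeffZ.
apply: (linear_monP L1 L2) => m'; rewrite lowerX /lower_mon mcoeffX.
case: eqP => [m'i|/eqP m'i].
  rewrite mcoeff0; case: eqP => // m'E; move: m'i.
  by rewrite m'E mnmDE mnm1E eqxx.
rewrite mcoeffX; congr (_%:R); congr nat_of_bool.
have m'E : (m' - U_(i) + U_(i) = m')%MM by rewrite submK // lep1mP.
by rewrite -{2}m'E addmC eqm_add2l.
Qed.

Lemma mcoeff_lower0 i p m : lower i p = 0 -> m i != 0%N -> p@_m = 0.
Proof.
move=> ip mi; have -> : m = (U_(i) + (m - U_(i)))%MM.
  by rewrite addmC submK // lep1mP.
by rewrite -mcoeff_lower ip mcoeff0.
Qed.

End ShiftOperators.

(** * Commutators with multiplication by a variable *)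

Section EndoRaise.

Variables (K : fieldType) (n : nat).
Local Notation P := {mpoly K[n]}.
Implicit Types (i j k : 'I_n) (m : 'X_{1..n}) (phi : endo K n).

Definition raise_comm phi k := phi * raise K k - raise K k * phi.

Lemma raise_commP phi k :
  raise_comm phi k = 0 -> forall p, phi ('X_k * p) = 'X_k * phi p.
Proof.
move=> /eqP; rewrite subr_eq0 => /eqP phik p.
exact: (congr1 (fun f : endo K n => f p) phik).
Qed.

Lemma raiseXn i r p : (raise K i ^+ r) p = 'X_i ^+ r * p.
Proof.
elim: r p => [|r IHr] p; first by rewrite !expr0 mul1r.
by rewrite !exprS endoME IHr -mulrA.
Qed.

Lemma raise_commE phi k r p : (raise_comm phi k * raise K k ^+ r) p =
  phi ('X_k ^+ r.+1 * p) - 'X_k * phi ('X_k ^+ r * p).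
Proof. by rewrite endoME raiseXn endoBE !endoME exprS -mulrA. Qed.

Lemma endo_monomial_comm phi m p :
  (forall i, m i != 0%N -> raise_comm phi i = 0) ->
  phi ('X_[m] * p) = 'X_[m] * phi p.
Proof.
move=> phiC; have phiXn i r q : raise_comm phi i = 0 ->
    phi ('X_i ^+ r * q) = 'X_i ^+ r * phi q.
  move=> /raise_commP phii; elim: r => [|r IHr]; first by rewrite !mul1r.
  by rewrite exprS -!mulrA phii IHr.
rewrite mpolyXE_id; elim: (index_enum _) p => [|i s IHs] p.
  by rewrite !big_nil !mul1r.
rewrite !big_cons -!mulrA; have [->|mi] := eqVneq (m i) 0%N.
  by rewrite expr0 !mul1r.
by rewrite phiXn ?phiC // IHs.
Qed.

(** Only the variables occurring in [p] are constrained: in [xtors_prime] the operator is known to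
    commute with a single [X_j], and [p] is a polynomial in [X_j] alone. *)
Lemma endo_poly_comm phi p q :
  (forall m i, m \in msupp p -> m i != 0%N -> raise_comm phi i = 0) ->
  phi (p * q) = p * phi q.
Proof.
move=> phiC; rewrite [p in LHS]mpolyE [p in RHS]mpolyE !mulr_suml.
have phi_sum s (F : 'X_{1..n} -> P) :
    phi (\sum_(m <- s) F m) = \sum_(m <- s) phi (F m).
  by elim: s => [|m s IHs]; rewrite ?(big_nil, big_cons) ?endo0 // endoD IHs.
rewrite phi_sum; apply: eq_big_seq => m mp.
by rewrite -!scalerAl endoZ endo_monomial_comm // => i; apply: phiC mp.
Qed.

Definition mzero i m := [multinom if k == i then 0%N else m k | k < n].

(* The operator linear in ['X_i] that agrees with [phi] on the polynomials
   free of ['X_i]. *)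
Definition freeze i phi : endo K n :=
  endo_lext (fun m => 'X_i ^+ (m i) * phi 'X_[mzero i m]).

Lemma freezeX i phi m :
  freeze i phi 'X_[m] = 'X_i ^+ (m i) * phi 'X_[mzero i m].
Proof. exact: lextX. Qed.

Lemma freeze_raise i phi : raise_comm (freeze i phi) i = 0.
Proof.
apply: endo_monP => m; rewrite endoBE !endoME raiseX !freezeX mnmDE mnm1E eqxx.
rewrite exprS (_ : mzero i _ = mzero i m) /= ?mulrA ?subrr //.
apply/mnmP => k; rewrite !mnmE; case: eqP => // /eqP.
by rewrite eq_sym => /negPf ->.
Qed.

(** Freezing only affects the exponent of [X_i]: the value at [X_[m]] is [X_i ^ (m i)] times the
    value of the original operator at [X_[mzero i m]]. *)
Lemma freeze_raise_neq i phi k r : k != i ->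
  raise_comm phi k * raise K k ^+ r = 0 ->
  raise_comm (freeze i phi) k * raise K k ^+ r = 0.
Proof.
move=> nki phik; apply: endo_monP => m.
have mz t : mzero i (U_(k) *+ t + m) = (U_(k) *+ t + mzero i m)%MM.
  apply/mnmP => l; rewrite !(mnmE, mulmnE).
  by case: eqP => // ->; rewrite (negPf nki) mul0n.
have freezeXk t : freeze i phi ('X_k ^+ t * 'X_[m]) =
    'X_i ^+ (m i) * phi ('X_k ^+ t * 'X_[mzero i m]).
  rewrite (mpolyXn _ _ t) -!mpolyXD freezeX mz.
  by rewrite mnmDE mulmnE mnm1E (negPf nki) mul0n.
rewrite raise_commE !freezeXk mulrCA -mulrBr -raise_commE phik endo0E.
by rewrite mulr0.
Qed.

(** A division of [phi] by [lower i] with remainder [freeze i phi]. On monomials free of [X_i] the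
    first term dies and the remainder agrees with [phi]; on the others [lower i] is undone by
    [raise i], with which the remainder commutes. *)
Lemma freezeK i phi :
  phi = (phi * raise K i - raise K i * freeze i phi) * lower K i + freeze i phi.
Proof.
apply: endo_monP => m; rewrite endoDE endoME lowerX /lower_mon.
case: eqP => [mi|/eqP mi].
  rewrite endo0 add0r freezeX mi expr0 mul1r (_ : mzero i m = m) //.
  by apply/mnmP => k; rewrite mnmE; case: eqP => // ->.
have mE : (U_(i) + (m - U_(i)) = m)%MM by rewrite addmC submK // lep1mP.
rewrite endoBE !endoME raiseX mE /=.
by rewrite -(raise_commP (freeze_raise i phi)) -mpolyXD mE subrK.
Qed.

End EndoRaise.

(** * Lowest terms and the divisors of a monomial *)

Lemma mcoeffM_mlast (K : fieldType) n (p q : {mpoly K[n]}) :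
  (p * q)@_(mlast p + mlast q) = p@_(mlast p) * q@_(mlast q).
Proof.
have [->|p0] := eqVneq p 0; first by rewrite mul0r !mcoeff0 mul0r.
have [->|q0] := eqVneq q 0; first by rewrite mulr0 !mcoeff0 mulr0.
rewrite mpolyME raddf_sum big_allpairs_dep /=.
rewrite (bigD1_seq (mlast p)) ?msupp_uniq ?mlast_supp //=.
rewrite (bigD1_seq (mlast q)) ?msupp_uniq ?mlast_supp //=.
rewrite mcoeffZ mcoeffX eqxx mulr1 big1_seq => [|m /andP[ml mq]]; last first.
  by rewrite mcoeffZ mcoeffX eqm_add2l (negPf ml) mulr0.
rewrite addr0 big1_seq ?addr0 // => m /andP[ml mp].
rewrite big1_seq // => k /andP[_ kq]; rewrite mcoeffZ mcoeffX.
have lt_lm : (mlast p < m)%O by rewrite lt_neqAle eq_sym ml mlast_lemc.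
by rewrite gt_eqF ?mulr0 // ltmc_le_add // mlast_lemc.
Qed.

(** Lowest and leading monomials both add up under products. As they coincide in [p * q], they
    coincide in each factor, which therefore has a single term. *)
Lemma mpoly_monomial_divisor (K : fieldType) n (p q : {mpoly K[n]}) m :
  p * q = 'X_[m] -> exists c d k l,
    [/\ p = c *: 'X_[k], q = d *: 'X_[l], m = (k + l)%MM, c != 0 & d != 0].
Proof.
move=> pq; have p0 : p != 0.
  apply/eqP => p0; move/eqP: pq; rewrite p0 mul0r eq_sym.
  by rewrite -msize_poly_eq0 msizeX.
have q0 : q != 0.
  apply/eqP => q0; move/eqP: pq; rewrite q0 mulr0 eq_sym.
  by rewrite -msize_poly_eq0 msizeX.
have c0 : p@_(mlast p) != 0 by rewrite mcoeff_eq0 negbK mlast_supp.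
have d0 : q@_(mlast q) != 0 by rewrite mcoeff_eq0 negbK mlast_supp.
have lastE : m = (mlast p + mlast q)%MM.
  have : (p * q)@_(mlast p + mlast q) != 0 by rewrite mcoeffM_mlast mulf_neq0.
  by rewrite pq mcoeffX; case: (m =P _) => //; rewrite eqxx.
have leadE : m = (mlead p + mlead q)%MM by rewrite -mleadM // pq mleadXm.
have le_p : (mlast p <= mlead p)%O by apply/msupp_le_mlead/mlast_supp.
have le_q : (mlast q <= mlead q)%O by apply/msupp_le_mlead/mlast_supp.
have eq_p : mlead p = mlast p.
  apply/esym/eqP; rewrite eq_le le_p leNgt; apply/negP => lt_p.
  have := ltmc_le_add lt_p le_q.
  by rewrite -?lastE -?leadE ltxx.
have eq_q : mlead q = mlast q.
  by move: leadE; rewrite lastE eq_p => /addmI ->.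
have mono (r : {mpoly K[n]}) :
    mlead r = mlast r -> r = r@_(mlast r) *: 'X_[mlast r].
  move=> rE; apply/mpolyP => k; rewrite mcoeffZ mcoeffX.
  case: eqP => [->|nk]; first by rewrite mulr1.
  rewrite mulr0; apply/memN_msupp_eq0/negP => kr; apply: nk.
  by apply/le_anti; rewrite mlast_lemc //= -rE msupp_le_mlead.
exists p@_(mlast p), q@_(mlast q), (mlast p), (mlast q).
by split=> //; apply: mono.
Qed.

(** The target is not commutative; commutation among the chosen elements is enough to collect their
    powers. *)
Lemma mmap1D_comm n (S : nzRingType) (h : 'I_n -> S) m1 m2 :
  (forall i j, GRing.comm (h i) (h j)) ->
  mmap1 h (m1 + m2) = mmap1 h m1 * mmap1 h m2.
Proof.
move=> hC; rewrite /mmap1 -prodrM_comm => [|i j _ _].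
  by apply: eq_bigr => i _; rewrite mnmDE exprD.
by apply/commr_sym/commrX/commr_sym/commrX.
Qed.

Lemma mmap1S_comm n (S : nzRingType) (h : 'I_n -> S) i m :
  (forall i j, GRing.comm (h i) (h j)) ->
  mmap1 h (U_(i) + m) = h i * mmap1 h m.
Proof. by move=> hC; rewrite mmap1D_comm // mmap1U. Qed.

(** * Algebras given by the presentation *)

Section SubAlgebra.

Variables (K : fieldType) (A : algType K) (S : subalgClosed A).

(** Turns a closed predicate into an algebra, to which initiality can be applied. *)
Record subalg := Subalg { subalg_val : A; _ : subalg_val \in S }.

HB.instance Definition _ := [isSub for subalg_val].
HB.instance Definition _ := [Choice of subalg by <:].
HB.instance Definition _ := [SubChoice_isSubAlgebra of subalg by <:].

End SubAlgebra.

Section KalgHom.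

Variables (K : fieldType) (A B : algType K) (f : A -> B).
Hypothesis homf : is_Kalg_hom f.

Lemma homM : {morph f : a b / a * b}. Proof. by case: homf. Qed.

Lemma hom1 : f 1 = 1. Proof. by case: homf. Qed.

Lemma homD : {morph f : a b / a + b}.
Proof. by case: homf => fL _ _ a b; have := fL 1 a b; rewrite !scale1r. Qed.

Lemma hom0 : f 0 = 0.
Proof. by apply: (addrI (f 0)); rewrite -homD !addr0. Qed.

Lemma homZ c a : f (c *: a) = c *: f a.
Proof. by case: homf => fL _ _; have := fL c a 0; rewrite hom0 !addr0. Qed.

Lemma homB : {morph f : a b / a - b}.
Proof. by move=> a b; rewrite -!scaleN1r homD homZ. Qed.

Lemma homX a k : f (a ^+ k) = f a ^+ k.
Proof. by elim: k => [|k IHk]; rewrite ?expr0 ?hom1 // !exprS homM IHk. Qed.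

End KalgHom.

Lemma hom_comp (K : fieldType) (A B C : algType K) (f : B -> C) (g : A -> B) :
  is_Kalg_hom f -> is_Kalg_hom g -> is_Kalg_hom (f \o g).
Proof.
move=> hf hg; split=> [c u v|u v|] /=.
- by rewrite (homD hg) (homZ hg) (homD hf) (homZ hf).
- by rewrite (homM hg) (homM hf).
- by rewrite (hom1 hg) (hom1 hf).
Qed.

Section Presentation.

Variables (K : fieldType) (n : nat) (A : algType K) (x y : 'I_n -> A).
Hypothesis presA : is_S_presentation x y.

Section Induction.

Variable Q : A -> Prop.
Hypotheses (Q1 : Q 1) (QL : forall c a b, Q a -> Q b -> Q (c *: a + b)).
Hypotheses (QM : forall a b, Q a -> Q b -> Q (a * b)).
Hypotheses (Qx : forall i, Q (x i)) (Qy : forall i, Q (y i)).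

Definition ind_pred : {pred A} := fun a => `[< Q a >].
Local Notation S := ind_pred.

Fact subalg_ind_closed : GRing.subsemialg_closed S.
Proof.
have inS a : (a \in S) = `[< Q a >] by [].
have Q0 : Q 0 by rewrite -[0](addNr 1) -scaleN1r; apply: QL.
split=> [||c a|a b]; rewrite ?inS .
- exact/asboolP.
- split=> [|a b]; rewrite ?inS; first exact/asboolP.
  move=> /asboolP Qa /asboolP Qb; apply/asboolP.
  by rewrite -[a]scale1r; apply: QL.
- by move=> /asboolP Qa; apply/asboolP; rewrite -[_ *: _]addr0; apply: QL.
- by move=> /asboolP Qa /asboolP Qb; apply/asboolP/QM.
Qed.

HB.instance Definition _ := GRing.isSubalgClosed.Build K A S subalg_ind_closed.

Let B : algType K := subalg S.

(** Initiality maps [A] to the subalgebra cut out by [Q]. Followed by the inclusion, this map fixes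
    the generators, so it is the identity and every element lies in the subalgebra. *)
Lemma presentation_ind a : Q a.
Proof.
have [relA initA] := presA.
pose xb i : B := Subalg (introT (asboolP _) (Qx i) : x i \in S).
pose yb i : B := Subalg (introT (asboolP _) (Qy i) : y i \in S).
have relB : S_relations xb yb.
  case: relA => yx comm; split=> [i|i j /comm [c1 c2 c3]].
    by apply: val_inj; apply: yx.
  by split; apply: val_inj.
have [[f [homf fxy]] _] := initA _ xb yb relB.
have [_ uniqA] := initA _ x y relA.
have hom_val : is_Kalg_hom (val : B -> A) by split.
have hom_id : is_Kalg_hom (id : A -> A) by split.
have <- : val (f a) = a.
  apply: (uniqA (val \o f) id (hom_comp hom_val homf) hom_id) => i /=.
  by have [-> ->] := fxy i.
by apply/asboolP; apply: valP (f a).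
Qed.

End Induction.

(** The target [K^o] is commutative, so [y_i x_i = 1] is the only constraint. These characters are
    later used to read off scalars, indices and exponents. *)
Lemma presentation_chi (mu : 'I_n -> K) :
  (forall i, mu i != 0) ->
  exists chi : A -> K^o, is_Kalg_hom chi /\
    forall i, chi (x i) = mu i /\ chi (y i) = (mu i)^-1.
Proof.
move=> mu0; have [_ /(_ K^o mu (fun i => (mu i)^-1))] := presA.
case=> [|//]; split=> [i|i j _]; first by rewrite mulVf.
by split; rewrite mulrC.
Qed.

Lemma presentation_rep : exists rep : A -> endo K n, is_Kalg_hom rep /\
  forall i, rep (x i) = raise K i /\ rep (y i) = lower K i.
Proof. by have [_ /(_ _ _ _ (shift_relations K n))] := presA; case. Qed.

End Presentation.

(** * Automorphisms and inner automorphisms of an arbitrary algebra *)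

Section Automorphisms.

Variables (K : fieldType) (A : algType K).
Implicit Types (f g h : A -> A).

Lemma aut_comp f g : is_Kalg_aut f -> is_Kalg_aut g -> is_Kalg_aut (f \o g).
Proof. by move=> [hf bf] [hg bg]; split; [apply: hom_comp|apply: bij_comp]. Qed.

Lemma aut_inverse f g : is_Kalg_aut f -> cancel f g -> cancel g f ->
  is_Kalg_aut g.
Proof.
move=> [hf bf] fK gK; have inj := bij_inj bf.
split; last by exists f.
split=> [c u v|u v|]; apply: inj.
- by rewrite (homD hf) (homZ hf) !gK.
- by rewrite (homM hf) !gK.
- by rewrite (hom1 hf) gK.
Qed.

Lemma aut_eq f g : (forall a, f a = g a) -> is_Kalg_aut f -> is_Kalg_aut g.
Proof. by move=> /funext ->. Qed.

Lemma inner_aut f : is_inner_aut f -> is_Kalg_aut f.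
Proof.
move=> [u [v [uv vu /funext ->]]]; split.
  split=> [c a b|a b|].
  - by rewrite mulrDr mulrDl -scalerAr -scalerAl.
  - by rewrite !mulrA -(mulrA _ v u) vu mulr1.
  - by rewrite mulr1 uv.
exists (fun a => v * a * u) => a.
  by rewrite !mulrA vu mul1r -mulrA vu mulr1.
by rewrite !mulrA uv mul1r -mulrA uv mulr1.
Qed.

Lemma inner_normal : is_normal_subgroup_aut (@is_inner_aut K A).
Proof.
split.
- exact: inner_aut.
- split=> [h h' /funext -> //|]; exists 1, 1.
  by split=> [||a]; rewrite ?mulr1 ?mul1r.
- move=> h g [u [v [uv vu hE]]] [u' [v' [uv' vu' gE]]].
  exists (u * u'), (v' * v); split=> [||a] /=.
  + by rewrite mulrA -(mulrA u) uv' mulr1.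
  + by rewrite mulrA -(mulrA v') vu mulr1.
  + by rewrite hE gE !mulrA.
- move=> h h' [u [v [uv vu hE]]] hK; exists v, u; split=> // a.
  have [_ <-] := hK (v * a * u); rewrite hE.
  by congr h'; rewrite !mulrA uv mul1r -mulrA uv mulr1.
- move=> g g' h [hg _] gK [u [v [uv vu hE]]]; exists (g u), (g v).
  split=> [||a] /=; rewrite -?(homM hg) ?uv ?vu ?(hom1 hg) //.
  by rewrite hE !(homM hg); have [-> _] := gK a.
Qed.

(** The images of a unit and of its inverse cancel in the commutative field [K]. *)
Lemma inner_char (chi : A -> K^o) w a :
  is_Kalg_hom chi -> is_inner_aut w -> chi (w a) = chi a.
Proof.
move=> hc [u [v [uv vu wE]]]; rewrite wE !(homM hc) mulrC mulrA -(homM hc) vu.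
by rewrite (hom1 hc) mul1r.
Qed.

End Automorphisms.

(** * Normal forms in the presented algebra *)

Section Representation.

Variables (K : fieldType) (n : nat) (A : algType K) (x y : 'I_n -> A).
Hypothesis presA : is_S_presentation x y.
Local Notation P := {mpoly K[n]}.

Lemma pres_yx i : y i * x i = 1.
Proof. by case: presA => [[yx _] _]. Qed.

Lemma pres_xx i j : GRing.comm (x i) (x j).
Proof.
have [->//|nij] := eqVneq i j.
by have [[_ /(_ i j nij)[]]] := presA.
Qed.

Lemma pres_yy i j : GRing.comm (y i) (y j).
Proof.
have [->//|nij] := eqVneq i j.
by have [[_ /(_ i j nij)[]]] := presA.
Qed.

Lemma pres_xy i j : i != j -> GRing.comm (x i) (y j).
Proof. by move=> nij; have [[_ /(_ i j nij)[]]] := presA. Qed.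

(** [theta] substitutes the [x_i] into a polynomial. [normal] takes polynomials with polynomial
    coefficients: the coefficients go to the left through [theta], and the outer variables become
    the [y_i] on the right. *)
Local Notation theta := (mmap (in_alg A) x).
Local Notation ymon := (mmap1 y).
Local Notation normal := (mmap theta y).

Fact theta_linear : linear theta.
Proof. by move=> c p q; rewrite mmapD mmapZ mulr_algl. Qed.

Fact theta_x i p : theta ('X_i * p) = x i * theta p.
Proof.
have L1 : linear (fun p => theta ('X_i * p)).
  by move=> c u v; rewrite -theta_linear mulrDr scalerAr.
have L2 : linear (fun p => x i * theta p).
  by move=> c u v; rewrite theta_linear mulrDr scalerAr.
apply: (linear_monP L1 L2) => m.
by rewrite -mpolyXD !mmapX mmap1S_comm //; apply: pres_xx.
Qed.

(* [p - 'X_i * lower i p] is the part of [p] free of ['X_i]. *)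
Fact y_theta i p :
  y i * theta p = theta (lower K i p) + theta (p - 'X_i * lower K i p) * y i.
Proof.
have L1 : linear (fun p => y i * theta p).
  by move=> c u v; rewrite theta_linear mulrDr scalerAr.
have L2 : linear (fun p =>
    theta (lower K i p) + theta (p - 'X_i * lower K i p) * y i).
  move=> c u v; rewrite endo_linear theta_linear mulrDr opprD addrACA.
  rewrite -scalerAr -scalerBr theta_linear mulrDl -scalerAl.
  by rewrite scalerDr addrACA.
apply: (linear_monP L1 L2) => m; rewrite lowerX /lower_mon.
case: eqP => [mi|/eqP mi].
  rewrite mulr0 subr0 raddf0 add0r mmapX; apply: commr_prod => k _.
  have [->|nki] := eqVneq k i; first by rewrite mi expr0; apply: commr1.
  by apply/commrX/commr_sym/pres_xy.
have mE : (U_(i) + (m - U_(i)) = m)%MM by rewrite addmC submK // lep1mP.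
rewrite -mpolyXD mE subrr raddf0 mul0r addr0 -{1}mE !mmapX.
by rewrite mmap1S_comm ?mulrA ?pres_yx ?mul1r //; apply: pres_xx.
Qed.

Fact normal_ind (Q : A -> Prop) :
  Q 0 -> (forall a b, Q a -> Q b -> Q (a + b)) ->
  (forall p b, Q (theta p * ymon b)) -> forall q, Q (normal q).
Proof. by move=> Q0 QD Qm q; apply: big_ind. Qed.

Fact normal_monomial p b : exists q, theta p * ymon b = normal q.
Proof.
have [->|p0] := eqVneq p 0; first by exists 0; rewrite !raddf0 mul0r.
exists (p *: 'X_[b]); rewrite {2}/mmap msuppMCX // big_seq1.
by rewrite mcoeffZ mcoeffX eqxx mulr1.
Qed.

(** Left multiplication by a generator preserves sums of normal terms: [x_i] is absorbed by [theta],
    and [y_i] is moved across by [y_theta]. *)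
Fact normal_form a : exists q, a = normal q.
Proof.
pose NF a := exists q, a = normal q.
have NF0 : NF 0 by exists 0; rewrite raddf0.
have NFD a1 a2 : NF a1 -> NF a2 -> NF (a1 + a2).
  by move=> [q1 ->] [q2 ->]; exists (q1 + q2); rewrite raddfD.
have NFZ c a1 : NF a1 -> NF (c *: a1).
  move=> [q ->]; elim/normal_ind: (normal q) => [|u v|p b].
  - by rewrite scaler0.
  - by rewrite scalerDr; apply: NFD.
  - rewrite scalerAl; have := theta_linear c p 0.
    by rewrite raddf0 !addr0 => <-; apply: normal_monomial.
have closed a1 : (forall p b, NF (a1 * (theta p * ymon b))) ->
    forall a2, NF a2 -> NF (a1 * a2).
  move=> H a2 [q ->]; elim/normal_ind: (normal q) => [|u v|p b //].
  - by rewrite mulr0.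
  - by rewrite mulrDr; apply: NFD.
(* The induction peels off left factors, hence the arbitrary normal term on the right; [p = 1] and
   [b = 0] recover [a]. *)
suff H p b : NF (a * (theta p * ymon b)).
  by have := H 1 0%MM; rewrite mmap11 -mpolyC1 mmapC /= scale1r !mulr1.
elim/(presentation_ind presA): a p b =>
  [p b|c a1 a2 H1 H2 p b|a1 a2 H1 H2 p b|i p b|i p b].
- by rewrite mul1r; apply: normal_monomial.
- by rewrite mulrDl -scalerAl; apply: NFD; first apply: NFZ.
- by rewrite -mulrA; apply: closed.
- by rewrite mulrA -theta_x; apply: normal_monomial.
- rewrite mulrA y_theta mulrDl -mulrA -mmap1S_comm; last exact: pres_yy.
  by apply: NFD; apply: normal_monomial.
Qed.

(** * Faithfulness and image of the polynomial representation *)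

Variable rep : A -> endo K n.
Hypothesis rep_hom : is_Kalg_hom rep.
Hypothesis rep_xy : forall i, rep (x i) = raise K i /\ rep (y i) = lower K i.

Lemma rep_x i p : rep (x i) p = 'X_i * p.
Proof. by have [-> _] := rep_xy i. Qed.

Lemma rep_y i : rep (y i) = lower K i.
Proof. by have [_ ->] := rep_xy i. Qed.

Lemma rep_xn i k p : rep (x i ^+ k) p = 'X_i ^+ k * p.
Proof.
elim: k p => [|k IHk] p; first by rewrite !expr0 (hom1 rep_hom) mul1r.
by rewrite !exprS (homM rep_hom) endoME rep_x IHk mulrA.
Qed.

Lemma rep_sum (I : Type) (s : seq I) (F : I -> A) p :
  rep (\sum_(i <- s) F i) p = \sum_(i <- s) rep (F i) p.
Proof.
elim: s => [|i s IHs]; first by rewrite !big_nil (hom0 rep_hom).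
by rewrite !big_cons (homD rep_hom) endoDE IHs.
Qed.

Lemma rep_xmon m p : rep (mmap1 x m) p = 'X_[m] * p.
Proof.
rewrite mpolyXE_id /mmap1; elim: (index_enum _) p => [|i s IHs] p.
  by rewrite !big_nil (hom1 rep_hom) mul1r.
by rewrite !big_cons (homM rep_hom) endoME IHs rep_xn mulrA.
Qed.

Lemma rep_theta p q : rep (theta p) q = p * q.
Proof.
rewrite {1}/mmap rep_sum [in RHS](mpolyE p) mulr_suml; apply: eq_bigr => m _.
by rewrite mulr_algl (homZ rep_hom) endoZE rep_xmon scalerAl.
Qed.

Lemma mcoeff_rep_yn i k p m :
  (rep (y i ^+ k) p)@_m = p@_(U_(i) *+ k + m).
Proof.
elim: k p m => [|k IHk] p m.
  by rewrite expr0 (hom1 rep_hom) mulm0n add0m.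
rewrite exprSr (homM rep_hom) endoME IHk rep_y mcoeff_lower.
by rewrite mulmS addmA.
Qed.

Lemma mcoeff_rep_ymon b p m : (rep (ymon b) p)@_m = p@_(b + m).
Proof.
rewrite {2}[b]multinomUE_id /mmap1.
elim: (index_enum _) p m => [|i s IHs] p m.
  by rewrite !big_nil (hom1 rep_hom) add0m.
rewrite !big_cons (homM rep_hom) endoME mcoeff_rep_yn IHs.
by rewrite addmA [(_ + U_(i) *+ _)%MM]addmC.
Qed.

(* Evaluating [normal q] at the lowest monomial [b] of [q] only leaves the
   coefficient of [b]. *)
Lemma rep_normal_mlast q : rep (normal q) 'X_[mlast q] = q@_(mlast q).
Proof.
have [->|q0] := eqVneq q 0; first by rewrite raddf0 (hom0 rep_hom) mcoeff0.
rewrite rep_sum (bigD1_seq (mlast q)) ?msupp_uniq ?mlast_supp //=.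
rewrite big1_seq ?addr0.
  rewrite (homM rep_hom) endoME rep_theta.
  rewrite (_ : rep _ _ = 1) ?mulr1 //; apply/mpolyP => m.
  rewrite mcoeff_rep_ymon mcoeffX mcoeff1 -{1}[mlast q]addm0.
  by rewrite eqm_add2l eq_sym.
move=> m /andP[ml mq]; rewrite (homM rep_hom) endoME rep_theta.
rewrite (_ : rep _ _ = 0) ?mulr0 //; apply/mpolyP => k.
rewrite mcoeff_rep_ymon mcoeffX mcoeff0; case: eqP => // mE; case/eqP: ml.
apply/le_anti; rewrite mlast_lemc // andbT; apply: lem_leo.
by rewrite mE lem_addr.
Qed.

(** A nonzero normal form does not kill its own lowest monomial. *)
Lemma rep_faithful : injective rep.
Proof.
move=> a b ab; apply/eqP; rewrite -subr_eq0.
have [q qE] := normal_form (a - b).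
have: rep (normal q) = 0 by rewrite -qE (homB rep_hom) ab subrr.
rewrite qE; have [->|q0 rq0] := eqVneq q 0; first by rewrite raddf0.
have := rep_normal_mlast q; rewrite rq0 => /esym/eqP.
by rewrite mcoeff_eq0 mlast_supp.
Qed.

(* Writing [phi = phi' * y_i + C] with [C] linear in ['X_i], one has
   [phi', x_i] x_i ^ N = [phi, x_i] x_i ^ (N + 1), so induction on [N] reduces
   to operators commuting with [x_i], one index [i] at a time. *)
Lemma rep_onto phi :
  (forall i, exists r, raise_comm phi i * raise K i ^+ r = 0) ->
  exists a, rep a = phi.
Proof.
(* Vacuous for the full list; as the list shrinks, it records the variables already known to commute
   with [phi]. *)
have: forall i, i \notin enum 'I_n -> raise_comm phi i = 0.
  by move=> i; rewrite mem_enum.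
elim: (enum 'I_n) phi => [|i s IHs] phi phi0 phiN.
  (* An operator commuting with every [X_i] is multiplication by its value at 1. *)
  exists (mmap (in_alg A) x (phi 1)); apply: endoP => p.
  rewrite rep_theta -[in RHS](mulr1 p) mulrC; apply/esym/endo_poly_comm.
  by move=> m i _ _; apply: phi0.
have [N phiiN] := phiN i.
elim: N phi phi0 phiN phiiN => [|N IHN] phi phi0 phiN phiiN.
  apply: IHs => // k ks; have [->|nki] := eqVneq k i.
    by rewrite -[LHS]mulr1.
  by apply: phi0; rewrite in_cons negb_or nki.
have freeze0 k : k \notin i :: s -> raise_comm (freeze i phi) k = 0.
  move=> kis; rewrite -[LHS]mulr1; apply: (@freeze_raise_neq _ _ i phi k 0).
    by move: kis; rewrite in_cons negb_or => /andP[].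
  by rewrite phi0 ?mul0r.
have freezeN k : exists r, raise_comm (freeze i phi) k * raise K k ^+ r = 0.
  have [->|nki] := eqVneq k i; first by exists 0%N; rewrite freeze_raise mul0r.
  by have [r phik] := phiN k; exists r; apply: freeze_raise_neq.
have [c cE] : exists c, rep c = freeze i phi.
  apply: IHs => // k ks; have [->|nki] := eqVneq k i; first exact: freeze_raise.
  by apply: freeze0; rewrite in_cons negb_or nki.
pose phi' := phi * raise K i - raise K i * freeze i phi.
have phi'E k : raise_comm phi' k =
    raise_comm phi k * raise K i - raise K i * raise_comm (freeze i phi) k.
  rewrite /raise_comm /phi' !mulrBl !mulrBr !mulrA (raiseC _ k i) -(mulrA phi).
  by rewrite (raiseC _ i k) mulrA !opprD !opprK addrACA.
have raiseCX k r : raise K i * raise K k ^+ r = raise K k ^+ r * raise K i.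
  by apply/commrX/raiseC.
have [b bE] : exists b, rep b = phi'.
  apply: IHN => [k kis|k|].
  - by rewrite phi'E phi0 // freeze0 // mul0r mulr0 subrr.
  - have [r1 E1] := phiN k; have [r2 E2] := freezeN k; exists (r1 + r2)%N.
    rewrite phi'E mulrBl -!mulrA raiseCX exprD !mulrA E1 !mul0r sub0r.
    rewrite -!mulrA -exprD addnC exprD [raise_comm _ _ * _]mulrA E2.
    by rewrite mul0r mulr0 oppr0.
  - by rewrite phi'E freeze_raise mulr0 subr0 -mulrA -exprS.
exists (b * y i + c); rewrite (homD rep_hom) (homM rep_hom) bE cE rep_y.
by rewrite -freezeK.
Qed.

Implicit Types (p q : P) (m : 'X_{1..n}) (i j k : 'I_n) (a b : A).

(** * Height one primes *)

(* The height one prime [p_j] of the algebra, i.e. the two-sided ideal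
   generated by [1 - x_j y_j]. *)
Definition xtors j (a : A) := exists r, a * x j ^+ r = 0.

Lemma xtors_ge j a r s : a * x j ^+ r = 0 -> (r <= s)%N -> a * x j ^+ s = 0.
Proof. by move=> ar /subnKC <-; rewrite exprD mulrA ar mul0r. Qed.

Lemma xtors0 j : xtors j 0.
Proof. by exists 0%N; rewrite mul0r. Qed.

Lemma xtorsD j a b : xtors j a -> xtors j b -> xtors j (a + b).
Proof.
move=> [r ar] [s bs]; exists (maxn r s); rewrite mulrDl.
by rewrite (xtors_ge ar) ?leq_maxl // (xtors_ge bs) ?leq_maxr // addr0.
Qed.

Lemma xtorsMl j a b : xtors j b -> xtors j (a * b).
Proof. by move=> [r br]; exists r; rewrite -mulrA br mulr0. Qed.

Lemma xtorsZ j c a : xtors j a -> xtors j (c *: a).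
Proof. by rewrite -mulr_algl; apply: xtorsMl. Qed.

(** Generators other than [y_j] commute with [x_j], and [y_j] cancels one extra factor [x_j]. *)
Lemma xtorsMr j a b : xtors j a -> xtors j (a * b).
Proof.
elim/(presentation_ind presA): b a =>
  [a|c b1 b2 H1 H2 a|b1 b2 H1 H2 a|k a|k a] ja.
- by rewrite mulr1.
- by rewrite mulrDr -scalerAr; apply: xtorsD (H2 _ ja); apply/xtorsZ/H1.
- by rewrite mulrA; apply/H2/H1.
- have [r ar] := ja; exists r; rewrite -mulrA (_ : x k * _ = x j ^+ r * x k).
    by rewrite mulrA ar mul0r.
  by apply/commrX/pres_xx.
- have [r ar] := ja; have [->|nkj] := eqVneq k j.
    by exists r.+1; rewrite exprS -mulrA (mulrA (y j)) pres_yx mul1r.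
  exists r; rewrite -mulrA (_ : y k * _ = x j ^+ r * y k).
    by rewrite mulrA ar mul0r.
  by apply/commrX/commr_sym/pres_xy; rewrite eq_sym.
Qed.

(** The commutator with [z] is a derivation and [xtors j] is a two-sided ideal, so generators
    suffice. *)
Lemma xtors_central j z a :
  (forall k, xtors j (z * x k - x k * z)) ->
  (forall k, xtors j (z * y k - y k * z)) -> xtors j (z * a - a * z).
Proof.
move=> zx zy; elim/(presentation_ind presA): a => [|c a b Ha Hb|a b Ha Hb|k|k].
- by rewrite mulr1 mul1r subrr; apply: xtors0.
- rewrite mulrDr mulrDl -scalerAr -scalerAl opprD addrACA -scalerBr.
  exact: xtorsD (xtorsZ _ Ha) Hb.
- have -> : z * (a * b) - a * b * z = (z * a - a * z) * b + a * (z * b - b * z).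
    by rewrite mulrBl mulrBr !mulrA addrA subrK.
  by apply: xtorsD; [apply: xtorsMr | apply: xtorsMl].
- exact: zx.
- exact: zy.
Qed.

Lemma xtors_yx j : xtors j (1 - x j * y j).
Proof.
by exists 1%N; rewrite expr1 mulrBl mul1r -mulrA pres_yx mulr1 subrr.
Qed.

Lemma xtors_x j a : xtors j (x j * a - a * x j).
Proof.
apply: xtors_central => k; first by rewrite pres_xx subrr; apply: xtors0.
have [->|nkj] := eqVneq k j.
  by rewrite pres_yx -opprB -scaleN1r; apply/xtorsZ/xtors_yx.
by rewrite pres_xy 1?eq_sym // subrr; apply: xtors0.
Qed.

Lemma xtors_y j a : xtors j (y j * a - a * y j).
Proof.
apply: xtors_central => k; last by rewrite pres_yy subrr; apply: xtors0.
have [->|nkj] := eqVneq k j; first by rewrite pres_yx; apply/xtors_yx.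
by rewrite pres_xy // subrr; apply: xtors0.
Qed.

(** * Simplicity of the polynomial module and implementation of automorphisms *)

Lemma rep_y_nilpotent i p : exists r, rep (y i ^+ r) p = 0.
Proof.
exists (msize p); apply/mpolyP => m; rewrite mcoeff_rep_yn mcoeff0.
apply/eqP; rewrite mcoeff_eq0; apply: msize_mdeg_ge.
by rewrite mdegD mdegMn mdeg1 mul1n leq_addr.
Qed.

(** For each index of [s] in turn, apply the largest power of [y_i] that does not annihilate the
    polynomial. The [y_i] commute, so what was killed before stays killed. *)
Lemma lower_to_kernel (s : seq 'I_n) p : p != 0 ->
  exists a, [/\ forall j, j \notin s -> GRing.comm a (x j), rep a p != 0
              & forall i, i \in s -> lower K i (rep a p) = 0].
Proof.
move=> p0; elim: s => [|i s [a [aC ap alow]]].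
  exists 1; split=> [j _||i]; rewrite ?(hom1 rep_hom) //.
  exact/commr_sym/commr1.
have ex : exists r, rep (y i ^+ r * a) p == 0.
  have [r ry] := rep_y_nilpotent i (rep a p).
  by exists r; rewrite (homM rep_hom) endoME ry.
(* The least annihilating exponent is positive since [rep a p] is nonzero; its predecessor is the
   power wanted. *)
case: (ex_minnP ex) => [[|r]] r0 rmin.
  by move: ap; rewrite -[a]mul1r (eqP r0) eqxx.
exists (y i ^+ r * a); split=> [j||k].
- rewrite in_cons negb_or => /andP[nji js]; apply/commr_sym/commrM.
    by apply/commrX/pres_xy.
  exact/commr_sym/aC.
- by apply/negP => /rmin; rewrite ltnn.
rewrite in_cons => /predU1P[->|ks].
  by rewrite -rep_y -endoME -(homM rep_hom) mulrA -exprS; apply/eqP.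
rewrite -rep_y -endoME -(homM rep_hom) mulrA.
rewrite (_ : y k * _ = y i ^+ r * y k); last by apply/commrX/pres_yy.
by rewrite !(homM rep_hom) !endoME rep_y alow // endo0.
Qed.

(** A nonzero polynomial killed by all lowering operators is a nonzero constant. The module is thus
    simple, as 1 generates it. *)
Lemma rep_simple p : p != 0 -> exists a, rep a p = 1.
Proof.
move=> p0; have [a [_ ap alow]] := lower_to_kernel (enum 'I_n) p0.
have apE : rep a p = ((rep a p)@_0)%:MP.
  apply/mpolyP => m; rewrite mcoeffC; have [->|m0] := eqVneq m 0%MM.
    by rewrite mulr1.
  rewrite mulr0; have [i mi] : exists i, m i != 0%N.
    apply/existsP; apply: contraNT m0 => /existsPn m0.
    by apply/eqP/mnmP => i; rewrite mnm0E; apply/eqP; rewrite -[_ == _]negbK.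
  by apply: (@mcoeff_lower0 _ _ i) => //; apply: alow; rewrite mem_enum.
exists (((rep a p)@_0)^-1 *: a); rewrite (homZ rep_hom) endoZE {2}apE.
rewrite -mul_mpolyC -mpolyCM mulVf ?mpolyC1 //.
by apply: contra_neq ap => a0; rewrite apE a0 mpolyC0.
Qed.

Fact rank_one_linear p : linear (fun q : P => q@_0 *: p).
Proof. by move=> c u v; rewrite mcoeffD mcoeffZ scalerDl scalerA. Qed.

(* [e p] is the rank one operator sending [1] to [p] and killing all other
   monomials; [p |-> e p] identifies the module with a minimal left ideal. *)
Lemma rank_one_exists :
  exists e : P -> A, forall p q, rep (e p) q = q@_0 *: p.
Proof.
suff /choice[e eE] : forall p, exists a, rep a = Endo (rank_one_linear p).
  by exists e => p q; rewrite eE.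
(* One power of [x_i] suffices: both terms of the commutator then take the constant coefficient of a
   multiple of [X_i]. *)
move=> p; apply: rep_onto => i; exists 1%N; apply: endoP => q.
have cX u : ('X_i * u)@_0 = 0 :> K.
  by rewrite rmorphM /= mcoeffX mnm1_eq0 mul0r.
by rewrite raise_commE /= !expr1 expr2 -mulrA !cX !scale0r mulr0 subrr.
Qed.

(** This makes [e] a morphism of left modules from the polynomials to the algebra. *)
Lemma rank_oneM (e : P -> A) : (forall p q, rep (e p) q = q@_0 *: p) ->
  forall a p, a * e p = e (rep a p).
Proof.
move=> eE a p; apply: rep_faithful; apply: endoP => q.
by rewrite (homM rep_hom) endoME !eE endoZ.
Qed.

Lemma rep_neq0 a : a != 0 -> exists p, rep a p != 0.
Proof.
move=> a0; apply: contrapT => H; case/eqP: a0; apply: rep_faithful.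
rewrite (hom0 rep_hom); apply: endoP => p.
by apply/eqP/negPn/negP => rap; apply: H; exists p.
Qed.

(** Take [phi p = sigma (e p) v] for some [v] not killed by [sigma (e 1)]. It intertwines the two
    actions because [e] is a module morphism; bijectivity comes from simplicity. *)
Lemma aut_implemented sigma : is_Kalg_aut sigma ->
  exists phi psi : endo K n, [/\ phi * psi = 1, psi * phi = 1
    & forall a, phi * rep a = rep (sigma a) * phi].
Proof.
move=> [hs [sigma' sK sK']]; have [e eE] := rank_one_exists.
have e1 p : rep (e p) 1 = p by rewrite eE mcoeff1 eqxx scale1r.
have eM := rank_oneM eE.
have [v v0] : exists v, rep (sigma (e 1)) v != 0.
  apply: rep_neq0; apply/eqP => /(congr1 sigma').
  rewrite sK -(hom0 hs) sK => /(congr1 rep) E.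
  by have /eqP := e1 1; rewrite E (hom0 rep_hom) eq_sym oner_eq0.
have phiL : linear (fun p => rep (sigma (e p)) v).
  move=> c p q /=; rewrite -endoZE -(homZ rep_hom) -endoDE -(homD rep_hom).
  rewrite -(homZ hs) -(homD hs); congr (rep (sigma _) v).
  apply: rep_faithful; apply: endoP => u.
  rewrite (homD rep_hom) (homZ rep_hom) endoDE endoZE !eE scalerDr.
  by rewrite !scalerA mulrC.
pose phi : endo K n := Endo phiL.
have phiM a p : phi (rep a p) = rep (sigma a) (phi p).
  by rewrite /= -eM (homM hs) (homM rep_hom).
have phi_inj : injective phi.
  move=> p q /eqP; rewrite -subr_eq0 => pq; apply/eqP; rewrite -subr_eq0.
  apply: contraTT pq => pq; have [a aE] := rep_simple pq.
  rewrite -scaleN1r -endoZ -endoD scaleN1r.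
  apply: contraNneq v0 => pq0.
  by have := phiM a (p - q); rewrite aE pq0 endo0 => <-.
have phi_surj q : exists p, phi p = q.
  (* Here [b] carries [phi 1] to 1, hence [e q * b] carries [phi 1] to [q]. *)
  have [b bE] := rep_simple v0; exists (rep (sigma' (e q * b)) 1).
  by rewrite phiM sK' (homM rep_hom) endoME /= bE e1.
have [psi psiK] := choice phi_surj.
have psiL : linear psi.
  by move=> c p q; apply: phi_inj; rewrite endoD endoZ !psiK.
exists phi, (Endo psiL); split; [apply: endoP|apply: endoP|] => p.
- exact: psiK.
- by apply: phi_inj; rewrite [LHS]psiK.
- by apply: endoP => q; rewrite !endoME phiM.
Qed.

(** * Primality of the ideals and their images under automorphisms *)

Lemma pres_yxn i r : y i ^+ r * x i ^+ r = 1.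
Proof.
elim: r => [|r IHr]; first by rewrite !expr0 mulr1.
by rewrite exprSr exprS mulrA -(mulrA _ (y i)) pres_yx mulr1.
Qed.

Lemma raise_comm_rep a k : GRing.comm a (x k) -> raise_comm (rep a) k = 0.
Proof.
move=> ak; rewrite /raise_comm; have [<- _] := rep_xy k.
by rewrite -!(homM rep_hom) ak subrr.
Qed.

(** The commutator with [x_j] lies in [xtors j], so multiplying by a high power of [x_j] gives exact
    commutation, without reaching zero. *)
Lemma xtors_regular j f : ~ xtors j f ->
  exists r F, [/\ F = f * x j ^+ r, GRing.comm F (x j) & F != 0].
Proof.
move=> nf; have [r fr] := xtors_x j f; exists r, (f * x j ^+ r); split=> //.
  move/eqP: fr; rewrite mulrBl subr_eq0 => /eqP; rewrite -!mulrA => fr.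
  by rewrite /GRing.comm -mulrA fr -exprSr -exprS.
by apply/eqP => f0; apply: nf; exists r.
Qed.

(** Replace [f] and [g] by nonzero [F] and [G] commuting with [x_j]. Lowering turns [G p] into a
    nonzero polynomial in [X_j] alone, over which [F] is linear; multiplying it by [q] with [F q]
    nonzero gives a nonzero value of the product. *)
Lemma xtors_prime j f g : ~ xtors j f -> ~ xtors j g ->
  exists a, ~ xtors j (f * a * g).
Proof.
move=> /xtors_regular[r [F [FE Fx F0]]] /xtors_regular[s [G [GE Gx G0]]].
have [p Gp] := rep_neq0 G0; have [q Fq] := rep_neq0 F0.
have [a [aC ap alow]] := lower_to_kernel [seq k <- enum 'I_n | k != j] Gp.
have aj : GRing.comm a (x j) by apply: aC; rewrite mem_filter eqxx.
set t := mmap (in_alg A) x q.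
have tj : GRing.comm t (x j).
  apply: rep_faithful; apply: endoP => u.
  by rewrite !(homM rep_hom) !endoME !rep_x !rep_theta mulrCA.
have bj : GRing.comm (t * a) (x j) by apply/commr_sym/commrM; apply/commr_sym.
have FbG0 : F * (t * a) * G != 0.
  apply/eqP => /(congr1 (fun b => rep b p)).
  rewrite (hom0 rep_hom) endo0E !(homM rep_hom) !endoME rep_theta mulrC.
  rewrite endo_poly_comm => [/eqP|m k mu mk].
    by rewrite mulf_eq0 (negPf ap) (negPf Fq).
  apply: raise_comm_rep; have [-> //|nkj] := eqVneq k j.
  move: mu; rewrite mcoeff_msupp => /eqP[]; apply: (@mcoeff_lower0 _ _ k) => //.
  by apply: alow; rewrite mem_filter nkj mem_enum.
exists (t * a) => -[N fbg]; case/eqP: FbG0.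
have FbGE : F * (t * a) * G = f * (t * a) * g * x j ^+ (s + r).
  rewrite FE -(mulrA f) (commr_sym (commrX r bj)) mulrA -(mulrA _ _ G).
  by rewrite (commr_sym (commrX r Gx)) GE exprD !mulrA.
have FbGj : GRing.comm (F * (t * a) * G) (x j).
  by apply/commr_sym/commrM; [apply/commrM|]; apply/commr_sym.
(* The product commutes with [x_j], so being killed by [x_j ^ N] on the right would make it zero, by
   [y_j ^ N x_j ^ N = 1]. *)
rewrite -[LHS]mul1r -(pres_yxn j N) -mulrA (commr_sym (commrX N FbGj)) FbGE.
rewrite -(mulrA _ _ (x j ^+ N)) -exprD addnC exprD (mulrA (f * _ * g)) fbg.
by rewrite mul0r mulr0.
Qed.

Lemma xtors1 j : ~ xtors j 1.
Proof.
move=> [r]; rewrite mul1r => xr0; have := pres_yxn j r.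
by rewrite xr0 mulr0 => /esym/eqP; rewrite oner_eq0.
Qed.

Lemma uniform_exponent (Q : 'I_n -> nat -> Prop) :
  (forall i r s, (r <= s)%N -> Q i r -> Q i s) ->
  (forall i, exists r, Q i r) -> exists r, forall i, Q i r.
Proof.
move=> Qmono /choice[r rQ]; exists (\max_i r i)%N => i.
exact: Qmono (leq_bigmax i) (rQ i).
Qed.

(** A common power [x_i ^ r] kills [g] on the right, so [g] vanishes on all but finitely many
    monomials; [e p * mmap1 y m] sends [X_[m]] to [p] and every other monomial to 0. *)
Lemma finite_rank_sum (e : P -> A) g :
  (forall p q, rep (e p) q = q@_0 *: p) -> (forall i, xtors i g) ->
  exists N, g = \sum_(m : 'X_{1..n < N}) e (rep g 'X_[m]) * mmap1 y m.
Proof.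
move=> eE gt; have [r gr] : exists r, forall i, g * x i ^+ r = 0.
  by apply: uniform_exponent gt => i r s rs gr; apply: xtors_ge gr rs.
(* Beyond degree [n * r], some exponent is at least [r]. *)
exists (n * r).+1; apply: rep_faithful; apply: endo_monP => k.
rewrite rep_sum; have [lt_k|le_k] := ltnP (mdeg k) (n * r).+1.
  rewrite (bigD1 (BMultinom lt_k)) //= big1 ?addr0 => [|m mk].
    rewrite (homM rep_hom) endoME eE mcoeff_rep_ymon mcoeffX addm0 eqxx.
    by rewrite scale1r.
  rewrite (homM rep_hom) endoME eE mcoeff_rep_ymon mcoeffX addm0.
  case: eqP => [kE|]; last by rewrite scale0r.
  by case/eqP: mk; apply: val_inj.
rewrite big1 => [|m _]; last first.
  rewrite (homM rep_hom) endoME eE mcoeff_rep_ymon mcoeffX addm0.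
  case: eqP => [kE|]; last by rewrite scale0r.
  by have := bmdeg m; rewrite -kE ltnNge le_k.
have /existsP[i ri] : [exists i, (r <= k i)%N].
  apply: contraLR le_k => /existsPn kr; rewrite -leqNgt mdegE.
  have -> : (n * r = \sum_(i < n) r)%N by rewrite sum_nat_const card_ord.
  apply: leq_sum => i _.
  by have := kr i; rewrite -ltnNge => /ltnW.
have -> : k = (U_(i) *+ r + (k - U_(i) *+ r))%MM.
  rewrite addmC submK //; apply/mnm_lepP => l; rewrite mulmnE mnm1E.
  by case: eqP => [<-|_]; rewrite ?mul1n ?mul0n.
by rewrite mpolyXD -mpolyXn -rep_xn -endoME -(homM rep_hom) gr (hom0 rep_hom).
Qed.

(* An automorphism permutes the height one primes. Otherwise, by primality,
   some [g] lying in every [p_i] has [sigma g] outside [p_j]; but the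
   intersection of the [p_i] is the minimal ideal, generated by the rank one
   idempotent, and is therefore preserved by [sigma]. *)
Lemma aut_xtors sigma j : is_Kalg_aut sigma ->
  exists i, forall a, xtors i a -> xtors j (sigma a).
Proof.
move=> [hs [sigma' sK sK']]; apply: contrapT => nH.
have {nH} H i : exists a, xtors i a /\ ~ xtors j (sigma a).
  apply: contrapT => nex; apply: nH; exists i => a ia.
  by apply: contrapT => ja; apply: nex; exists a.
have [e eE] := rank_one_exists; have eM := rank_oneM eE.
have e1 p : rep (e p) 1 = p by rewrite eE mcoeff1 eqxx scale1r.
have [g [gt ng]] : exists g, (forall i, i \in enum 'I_n -> xtors i g) /\
    ~ xtors j (sigma g).
  elim: (enum 'I_n) => [|i s [g [gt ng]]].
    by exists 1; split=> //; rewrite (hom1 hs); apply: xtors1.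
  have [a [ia ja]] := H i; have [b nb] := xtors_prime ja ng.
  (* The image is [sigma a * b * sigma g], outside the prime by the choice of [b]. *)
  exists (a * sigma' b * g); split; last by rewrite !(homM hs) sK'.
  move=> k; rewrite in_cons => /predU1P[->|ks]; first by do 2!apply: xtorsMr.
  by apply/xtorsMl/gt.
have [N gE] : exists N,
    g = \sum_(m : 'X_{1..n < N}) e (rep g 'X_[m]) * mmap1 y m.
  by apply: finite_rank_sum => // i; apply: gt; rewrite mem_enum.
(* As [e 1] factors through [sigma' (e 1)], its image factors through [e 1], which [x_j] kills on
   the right. *)
have je1 : xtors j (sigma (e 1)).
  have [v v0] : exists v, rep (sigma' (e 1)) v != 0.
    apply: rep_neq0; apply/eqP => /(congr1 sigma); rewrite sK' (hom0 hs).
    move=> /(congr1 rep) E; have /eqP := e1 1.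
    by rewrite E (hom0 rep_hom) eq_sym oner_eq0.
  have [b bE] := rep_simple v0.
  have -> : e 1 = b * sigma' (e 1) * e v.
    by rewrite eM (homM rep_hom) endoME bE.
  rewrite !(homM hs) sK'; apply/xtorsMr/xtorsMl; exists 1%N.
  apply: rep_faithful; apply: endoP => q; rewrite expr1 (hom0 rep_hom).
  rewrite (homM rep_hom) endoME eE rep_x rmorphM /= mcoeffX mnm1_eq0.
  by rewrite mul0r scale0r.
apply: ng; rewrite gE; elim/big_rec: _ => [|m h _ jh].
  by rewrite (hom0 hs); apply: xtors0.
rewrite (homD hs); apply: xtorsD jh; rewrite (homM hs); apply: xtorsMr.
by rewrite -(e1 (rep g _)) -eM (homM hs); apply: xtorsMl.
Qed.

(** Times a high power of [x_j], [z] commutes with every [x_i], so it acts as multiplication by its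
    value at 1. *)
Lemma central_mod_xtors j z : (forall a, xtors j (z * a - a * z)) ->
  exists r u, forall p, rep z ('X_j ^+ r * p) = u * p.
Proof.
move=> zC; have [r zr] : exists r, forall i, (z * x i - x i * z) * x j ^+ r = 0.
  apply: uniform_exponent => [i r s rs zr|i]; last exact: zC.
  exact: xtors_ge zr rs.
exists r, (rep z ('X_j ^+ r)) => p; rewrite -!rep_xn -!endoME -!(homM rep_hom).
rewrite -{1}(mulr1 p) endo_poly_comm.
  by rewrite (homM rep_hom) endoME rep_xn mulr1 mulrC.
move=> m i _ _.
apply: raise_comm_rep; move/eqP: (zr i); rewrite mulrBl subr_eq0 => /eqP zri.
rewrite /GRing.comm mulrA -zri -!mulrA; congr (z * _).
by apply/commr_sym/commrX/pres_xx.
Qed.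

(* Modulo [p_j], [sigma (x_i)] and [sigma (y_i)] are central and mutually
   inverse, hence monomials in [x_j ^ (+-1)]. The exponent is positive as
   [sigma (y_i)] is locally nilpotent, like [y_i]. *)
Lemma aut_x_monomial sigma j : is_Kalg_aut sigma ->
  exists i r t c, c != 0 /\ sigma (x i) * x j ^+ r = c *: x j ^+ (r + t.+1).
Proof.
move=> As; have [i ij] := aut_xtors j As; exists i.
have [phi [psi [phiK psiK phiE]]] := aut_implemented As.
have [hs [sigma' sK sK']] := As.
have imC b : (forall a, xtors i (b * a - a * b)) ->
    forall a, xtors j (sigma b * a - a * sigma b).
  by move=> bC a; rewrite -(sK' a) -!(homM hs) -(homB hs); apply/ij/bC.
have [r [u zE]] := central_mod_xtors (imC _ (xtors_x i)).
have [s [w yE]] := central_mod_xtors (imC _ (xtors_y i)).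
(* The image of [y_i x_i = 1], evaluated at a power of [X_j], makes [u] and [w] divisors of a
   monomial. *)
have wu : w * u = 'X_j ^+ (s + r).
  rewrite -yE mulrC -zE -endoME -(homM rep_hom) -(homM hs) pres_yx (hom1 hs).
  by rewrite (hom1 rep_hom) exprD mulrC.
have [d [c [l [k [wE uE lk d0 c0]]]]] :=
  mpoly_monomial_divisor (etrans wu (mpolyXn _ _ _)).
have lkj i' : i' != j -> l i' = 0%N /\ k i' = 0%N.
  move=> nij; have /eqP := congr1 (fun m : 'X_{1..n} => m i') lk.
  rewrite mulmnE mnm1E [j == _]eq_sym (negPf nij) mul0n mnmDE eq_sym addn_eq0.
  by case/andP=> /eqP-> /eqP->.
have lE : 'X_[l] = 'X_j ^+ l j :> P.
  rewrite mpolyXn; congr 'X_[_]; apply/mnmP => i'; rewrite mulmnE mnm1E.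
  by case: eqP => [<-|/eqP]; rewrite ?mul1n // eq_sym => /lkj[->].
have kE : 'X_[k] = 'X_j ^+ k j :> P.
  rewrite mpolyXn; congr 'X_[_]; apply/mnmP => i'; rewrite mulmnE mnm1E.
  by case: eqP => [<-|/eqP]; rewrite ?mul1n // eq_sym => /lkj[_ ->].
have lkE : (s + r = l j + k j)%N.
  have := congr1 (fun m : 'X_{1..n} => m j) lk.
  by rewrite mulmnE mnm1E eqxx mul1n mnmDE.
(* If [k j <= r], all powers of [sigma (y_i)] send [X_j ^ s] to nonzero multiples of powers of
   [X_j], against local nilpotence. *)
have [le_kr|lt_rk] := leqP (k j) r.
  have [t lt] : exists t, l j = (s + t)%N.
    exists (l j - s)%N; rewrite subnKC // -(leq_add2r r) lkE.
    by rewrite leq_add2l.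
  have powE N : exists e v, e != 0 /\
      rep (sigma (y i) ^+ N) ('X_j ^+ s) = e *: 'X_j ^+ (s + v).
    elim: N => [|N [e [v [e0 IHN]]]].
      exists 1, 0%N; split; first exact: oner_neq0.
      by rewrite expr0 (hom1 rep_hom) addn0 scale1r.
    exists (e * d), (t + v)%N; split; first exact: mulf_neq0.
    rewrite exprS (homM rep_hom) endoME IHN endoZ exprD yE wE lE lt.
    by rewrite -scalerAl -exprD scalerA addnA.
  have [N yN] := rep_y_nilpotent i (psi ('X_j ^+ s)).
  have [e [v [e0]]] := powE N.
  rewrite -[X in rep _ X]/((1 : endo K n) ('X_j ^+ s)) -phiK endoME.
  rewrite -(homX hs) -endoME -phiE endoME yN endo0 => /esym/eqP.
  by rewrite scaler_eq0 (negPf e0) /= mpolyXn -msize_poly_eq0 msizeX.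
exists r, (k j - r.+1)%N, c; split=> //; rewrite addnS -addSn subnKC //.
apply: rep_faithful; apply: endoP => p.
rewrite (homM rep_hom) endoME rep_xn zE uE kE.
by rewrite (homZ rep_hom) endoZE rep_xn scalerAl.
Qed.

(** * The automorphism group *)

Hypothesis char0 : [pchar K] =i pred0.
Implicit Types chi : A -> K^o.

Lemma two_neq0 : 2 != 0 :> K.
Proof. by have /(pcharf0P K) -> := char0. Qed.

(** In characteristic zero 2 is not a root of unity, so the character value 2 detects exponents. *)
Lemma two_exp_inj r s : 2 ^+ r = 2 ^+ s :> K -> r = s.
Proof.
wlog le_rs : r s / (r <= s)%N => [IH|].
  by case: (leqP r s) => [/IH//|/ltnW/IH H /esym/H].
rewrite -(subnKC le_rs) exprD -[LHS]mulr1 => /(mulfI (expf_neq0 _ two_neq0)).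
move=> /esym/eqP; case: (s - r)%N => [|d]; first by rewrite addn0.
rewrite -subr_eq0 -natrX -(natrB _ (expn_gt0 2 d.+1)).
have /(pcharf0P K) -> := char0; rewrite subn_eq0 leqNgt.
by rewrite -[X in (X < _)%N](expn0 2) ltn_exp2l.
Qed.

Lemma char_x_neq0 chi i : is_Kalg_hom chi -> chi (x i) != 0.
Proof.
move=> hc; apply/eqP => xi0; have := hom1 hc.
by rewrite -(pres_yx i) (homM hc) xi0 mulr0 => /esym/eqP; rewrite oner_eq0.
Qed.

Lemma char_one : exists chi, is_Kalg_hom chi /\ forall i, chi (x i) = 1.
Proof.
have [chi [hc chiE]] := presentation_chi presA (fun=> oner_neq0 K).
by exists chi; split=> // i; have [-> _] := chiE i.
Qed.

Lemma char_two j : exists chi, is_Kalg_hom chi /\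
  forall i, chi (x i) = if i == j then 2 else 1.
Proof.
have [|chi [hc chiE]] :=
    presentation_chi presA (mu := fun i => if i == j then 2 else 1).
  by move=> i; case: (i == j); [apply: two_neq0|apply: oner_neq0].
by exists chi; split=> // i; have [-> _] := chiE i.
Qed.

(** The character equal to 1 on all [x_i] compares the scalars; the one singling out [i] by the
    value 2 compares the indices. *)
Lemma char_sep c d i j : c != 0 ->
  (forall chi, is_Kalg_hom chi -> c * chi (x i) = d * chi (x j)) ->
  c = d /\ i = j.
Proof.
move=> c0 cd; have E : c = d.
  by have [chi [hc chiE]] := char_one; have := cd _ hc; rewrite !chiE !mulr1.
split=> //; have [chi [hc chiE]] := char_two i; have := cd _ hc.
rewrite -E !chiE eqxx => /(mulfI c0); rewrite eq_sym; case: eqP => // _ /eqP.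
by rewrite -subr_eq0 (addrK 1 1) oner_eq0.
Qed.

Lemma char_monomial chi a j r t c : is_Kalg_hom chi ->
  a * x j ^+ r = c *: x j ^+ (r + t) -> chi a = c * chi (x j) ^+ t.
Proof.
move=> hc /(congr1 chi); rewrite (homM hc) (homZ hc) !(homX hc) addnC exprD.
move=> E; apply: (mulIf (expf_neq0 r (char_x_neq0 j hc))).
by rewrite E -mulrA.
Qed.

(* The exponents of [sigma] and of its inverse multiply to 1, as one sees by
   evaluating the characters with values 1 and 2 on the generators. *)
Lemma aut_x_linear sigma : is_Kalg_aut sigma ->
  exists (pi : 'S_n) (c : 'I_n -> K), forall j, c j != 0 /\
    exists r, sigma (x (pi j)) * x j ^+ r = c j *: x j ^+ r.+1.
Proof.
move=> As; have [hs [sigma' sK sK']] := As.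
have As' := aut_inverse As sK sK'.
have /choice[pi /choice[r /choice[t /choice[c cE]]]] :=
  fun j => aut_x_monomial j As.
have /choice[pi' /choice[r' /choice[t' /choice[c' cE']]]] :=
  fun j => aut_x_monomial j As'.
have chiE chi j : is_Kalg_hom chi ->
    chi (sigma (x (pi j))) = c j * chi (x j) ^+ (t j).+1.
  by move=> hc; have [_ /(char_monomial hc)] := cE j.
(* For [i] and [j] distinct with the same image, the scalars agree, and the character with value 2
   at [x_i] would make a positive power of 2 equal to 1. *)
have pi_inj : injective pi.
  move=> i j pij; apply/eqP; apply: contraT => nij.
  have cij : c i = c j.
    have [chi [hc chi1]] := char_one; have := chiE chi i hc.
    by rewrite pij chiE // !chi1 !expr1n !mulr1.
  have [chi [hc chi2]] := char_two i; have := chiE chi i hc.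
  rewrite pij chiE // !chi2 eqxx eq_sym (negPf nij) expr1n cij.
  have [c0 _] := cE j; move=> /(mulfI c0); rewrite -(expr0 2).
  by move=> /two_exp_inj.
have t0 j : t j = 0%N.
  have chiE' chi : is_Kalg_hom chi -> chi (x (pi' (pi j))) =
      c' (pi j) * (c j * chi (x j) ^+ (t j).+1) ^+ (t' (pi j)).+1.
    move=> hc; have [_ /(char_monomial (hom_comp hc hs)) /=] := cE' (pi j).
    by rewrite sK' chiE.
  have cc : c' (pi j) * c j ^+ (t' (pi j)).+1 = 1.
    have [chi [hc chi1]] := char_one; have := chiE' chi hc.
    by rewrite !chi1 expr1n mulr1.
  have [chi [hc chi2]] := char_two j; have := chiE' chi hc.
  rewrite exprMn mulrA cc mul1r !chi2 eqxx -exprM.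
  case: eqP => _; last by rewrite -[LHS](expr0 2) => /two_exp_inj.
  rewrite -[LHS](expr1 2) => /two_exp_inj/esym/eqP.
  by rewrite muln_eq1 => /andP[/eqP[]].
exists (perm pi_inj), c => j; have [c0 E] := cE j; split=> //.
by exists (r j); rewrite permE E t0 addn1.
Qed.

Lemma aut_char_x sigma i : is_Kalg_aut sigma ->
  exists j c, c != 0 /\
    forall chi, is_Kalg_hom chi -> chi (sigma (x i)) = c * chi (x j).
Proof.
move=> As; have [pi [c cE]] := aut_x_linear As.
exists ((pi^-1)%g i), (c ((pi^-1)%g i)); have [c0 [r E]] := cE ((pi^-1)%g i).
split=> // chi hc; rewrite permKV -addn1 in E.
by rewrite (char_monomial hc E) expr1.
Qed.

(** By [rep_onto] both [phi] and [psi] come from the algebra, giving a unit and its inverse. The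
    condition for [phi] uses the inverse of [sigma], the one for [psi] uses [sigma]. *)
Lemma aut_unipotent_inner sigma : is_Kalg_aut sigma ->
  (forall i, exists r, sigma (x i) * x i ^+ r = x i ^+ r.+1) ->
  is_inner_aut sigma.
Proof.
move=> As sx; have [hs [sigma' sK sK']] := As.
have As' := aut_inverse As sK sK'.
(* By [aut_x_linear] the inverse has this shape up to a permutation and scalars, which the
   characters show to be trivial. *)
have sx' i : exists r, sigma' (x i) * x i ^+ r = x i ^+ r.+1.
  have [pi [c cE]] := aut_x_linear As'.
  have [c0 [r E]] := cE i; have [] := @char_sep 1 (c i) (pi i) i (oner_neq0 K).
    move=> chi hc; have sxE k : chi (sigma (x k)) = chi (x k).
      have [s Ek] := sx k; move: Ek; rewrite -addn1 -[RHS]scale1r.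
      by move=> /(char_monomial hc) ->; rewrite mul1r expr1.
    have := E; rewrite -addn1 => /(char_monomial (hom_comp hc hs)) /=.
    by rewrite sK' expr1 sxE mul1r.
  by move=> c1 pii; exists r; move: E; rewrite pii -c1 scale1r.
have [phi [psi [phiK psiK phiE]]] := aut_implemented As.
have psiE a : psi * rep (sigma a) = rep a * psi.
  by rewrite -[RHS]mul1r -psiK -!mulrA (mulrA phi) phiE -mulrA phiK mulr1.
have phiE' a : phi * rep (sigma' a) = rep a * phi by rewrite phiE sK'.
have raise_comm0 (f : endo K n) g i r : f * rep (g (x i)) = rep (x i) * f ->
    g (x i) * x i ^+ r = x i ^+ r.+1 ->
    raise_comm f i * raise K i ^+ r = 0.
  move=> fg gx; rewrite /raise_comm; have [<- _] := rep_xy i.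
  rewrite -fg -mulrBr -(homB rep_hom) -(homX rep_hom) -mulrA -(homM rep_hom).
  by rewrite mulrBl gx -exprS subrr (hom0 rep_hom) mulr0.
have [u uE] : exists u, rep u = phi.
  by apply: rep_onto => i; have [r E] := sx' i; exists r; apply: raise_comm0 E.
have [v vE] : exists v, rep v = psi.
  by apply: rep_onto => i; have [r E] := sx i; exists r; apply: raise_comm0 E.
have uv : u * v = 1.
  by apply: rep_faithful; rewrite (homM rep_hom) uE vE phiK (hom1 rep_hom).
exists u, v; split=> // [|a]; apply: rep_faithful.
  by rewrite (homM rep_hom) uE vE psiK (hom1 rep_hom).
by rewrite !(homM rep_hom) uE vE phiE -mulrA phiK mulr1.
Qed.

(** * Permutations, the torus and the decomposition *)

Lemma hom_exists (xb yb : 'I_n -> A) : S_relations xb yb ->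
  exists f : A -> A, is_Kalg_hom f /\
    forall i, f (x i) = xb i /\ f (y i) = yb i.
Proof. by have [_ initA] := presA; case/initA. Qed.

Lemma hom_unique (f g : A -> A) : is_Kalg_hom f -> is_Kalg_hom g ->
  (forall i, f (x i) = g (x i) /\ f (y i) = g (y i)) -> forall a, f a = g a.
Proof. by have [relA initA] := presA; have [_] := initA _ _ _ relA; apply. Qed.

Lemma aut_mutual_inverse (f g : A -> A) : is_Kalg_hom f -> is_Kalg_hom g ->
  (forall i, g (f (x i)) = x i /\ g (f (y i)) = y i) ->
  (forall i, f (g (x i)) = x i /\ f (g (y i)) = y i) ->
  cancel f g /\ cancel g f.
Proof.
move=> hf hg gf fg; have hid : is_Kalg_hom (id : A -> A) by split.
by split=> a; [apply: (hom_unique (hom_comp hg hf) hid)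
              |apply: (hom_unique (hom_comp hf hg) hid)].
Qed.

Lemma perm_hom (pi : 'S_n) : exists f : A -> A, is_Kalg_hom f /\
  forall i, f (x i) = x (pi i) /\ f (y i) = y (pi i).
Proof.
apply: hom_exists; have [[yx rel] _] := presA.
split=> [i|i j nij]; first exact: yx.
by apply: rel; rewrite (inj_eq perm_inj).
Qed.

Lemma perm_aut_exists (pi : 'S_n) : exists f g, [/\ is_perm_aut x y f,
  cancel f g, cancel g f & forall i, g (x (pi i)) = x i].
Proof.
have [f [hf fE]] := perm_hom pi; have [g [hg gE]] := perm_hom pi^-1.
have gf i : g (f (x i)) = x i /\ g (f (y i)) = y i.
  by have [-> ->] := fE i; have [-> ->] := gE (pi i); rewrite permK.
have fg i : f (g (x i)) = x i /\ f (g (y i)) = y i.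
  by have [-> ->] := gE i; have [-> ->] := fE ((pi^-1)%g i); rewrite permKV.
have [fK gK] := aut_mutual_inverse hf hg gf fg.
exists f, g; split=> // [|i]; first by split; [split=> //; exists g|exists pi].
by have [-> _] := gE (pi i); rewrite permK.
Qed.

Lemma torus_hom (c : 'I_n -> K) : (forall i, c i != 0) ->
  exists f : A -> A, is_Kalg_hom f /\
  forall i, f (x i) = c i *: x i /\ f (y i) = (c i)^-1 *: y i.
Proof.
move=> c0; apply: hom_exists; have [[yx rel] _] := presA.
split=> [i|i j nij].
  by rewrite -scalerAl -scalerAr scalerA mulVf // yx scale1r.
have [xy xx yy] := rel i j nij.
by split; rewrite -!scalerAl -!scalerAr !scalerA 1?mulrC ?xy ?xx ?yy.
Qed.

Lemma torus_aut_exists (c : 'I_n -> K) : (forall i, c i != 0) ->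
  exists f g, [/\ is_torus_aut x y f, cancel f g, cancel g f
                & forall i, g (x i) = (c i)^-1 *: x i].
Proof.
move=> c0; have [f [hf fE]] := torus_hom c0.
have [g [hg gE]] : exists g : A -> A, is_Kalg_hom g /\ forall i,
    g (x i) = (c i)^-1 *: x i /\ g (y i) = (c i)^-1^-1 *: y i.
  by apply: torus_hom => i; rewrite invr_eq0.
have gf i : g (f (x i)) = x i /\ g (f (y i)) = y i.
  have [-> ->] := fE i; rewrite !(homZ hg); have [-> ->] := gE i.
  by rewrite !scalerA invrK mulfV ?mulVf // !scale1r.
have fg i : f (g (x i)) = x i /\ f (g (y i)) = y i.
  have [-> ->] := gE i; rewrite !(homZ hf); have [-> ->] := fE i.
  by rewrite !scalerA invrK mulfV ?mulVf // !scale1r.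
have [fK gK] := aut_mutual_inverse hf hg gf fg.
exists f, g; split=> // [|i]; last by have [] := gE i.
by split; [split=> //; exists g|exists c].
Qed.

Lemma aut_decomposition sigma : is_Kalg_aut sigma ->
  exists tau t w : A -> A,
    [/\ is_perm_aut x y tau, is_torus_aut x y t, is_inner_aut w
      & forall a, sigma a = tau (t (w a))].
Proof.
move=> As; have [pi [c cE]] := aut_x_linear As.
(* [aut_x_linear] relates [sigma (x (pi j))] to [x j], so the permutation to factor out is the
   inverse of [pi]. *)
have [tau [tau' [Ptau tauK tauK' tauE]]] := perm_aut_exists pi^-1.
have l0 i : c ((pi^-1)%g i) != 0 by have [] := cE ((pi^-1)%g i).
have [t [t' [Tt tK tK' tE]]] := torus_aut_exists l0.
have Atau' : is_Kalg_aut tau' by apply: (aut_inverse _ tauK tauK'); case: Ptau.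
have At' : is_Kalg_aut t' by apply: (aut_inverse _ tK tK'); case: Tt.
have Aw := aut_comp At' (aut_comp Atau' As).
exists tau, t, (t' \o (tau' \o sigma)).
split=> // [|a /=]; last by rewrite tK' tauK'.
apply: aut_unipotent_inner => // i /=.
pose j := (pi^-1)%g i; have [c0 [r E]] := cE j; exists r.
have [[ht' _] [htau' _]] := (At', Atau').
have := congr1 (fun a => t' (tau' a)) E.
rewrite permKV (homM htau') (homM ht') (homZ htau') (homZ ht').
rewrite !(homX htau') !(homX ht') tauE tE -/j !exprZn -scalerAr scalerA.
rewrite exprS mulrA mulfV // mul1r.
(* Clears the scalar that [t'] put on the factor [x i ^+ r]. *)
move/(congr1 (fun a => c j ^+ r *: a)); rewrite !scalerA exprVn.
by rewrite mulfV ?expf_neq0 // !scale1r.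
Qed.

(** Inner factors are invisible to characters and torus factors rescale. Conversely, in the
    decomposition of [sigma] a rescaling of each [chi (x i)] leaves no room for a permutation, by
    [char_sep]. *)
Lemma torus_inner_char sigma : is_torus_inner_aut x y sigma <->
  is_Kalg_aut sigma /\ forall i, exists c, c != 0 /\
    forall chi, is_Kalg_hom chi -> chi (sigma (x i)) = c * chi (x i).
Proof.
split=> [[t [w [[At [c [c0 tE]]] Iw sE]]]|[As sE]].
  split=> [|i].
    by apply: aut_eq (aut_comp At (inner_aut Iw)) => a; rewrite sE.
  exists (c i); split=> // chi hc; have [ht _] := At.
  rewrite sE; have /= -> := inner_char (x i) (hom_comp hc ht) Iw.
  have [-> _] := tE i.
  by rewrite (homZ hc).
have [tau [t [w [Pt Tt Iw tE]]]] := aut_decomposition As.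
have [[htau _] [pi piE]] := Pt; have [[ht _] [l [l0 lE]]] := Tt.
exists t, w; split=> // a; rewrite tE.
have pi1 i : pi i = i.
  have [c [c0 cE]] := sE i; have [] := @char_sep (l i) c (pi i) i => //.
  move=> chi hc; rewrite -cE // tE.
  have /= -> := inner_char (x i) (hom_comp hc (hom_comp htau ht)) Iw.
  by have [-> _] := lE i; rewrite (homZ htau) (homZ hc); have [-> _] := piE i.
have hid : is_Kalg_hom (id : A -> A) by split.
by apply: (hom_unique htau hid) => i; have := piE i; rewrite pi1.
Qed.

Lemma torus_inner_normal : is_normal_subgroup_aut (is_torus_inner_aut x y).
Proof.
split.
- by move=> h /torus_inner_char[].
- split=> [h h' /funext -> //|]; apply/torus_inner_char; split.
    by split; [split|exists id].
  by move=> i; exists 1; split=> [|chi _]; rewrite ?oner_neq0 ?mul1r.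
- move=> h g /torus_inner_char[Ah hE] /torus_inner_char[Ag gE].
  apply/torus_inner_char; split=> [|i]; first exact: aut_comp.
  have [[c [c0 cE]] [d [d0 dE]]] := (hE i, gE i); have [hh _] := Ah.
  exists (d * c); split=> [|chi hc /=]; first exact: mulf_neq0.
  by have /= -> := dE _ (hom_comp hc hh); rewrite cE // mulrA.
- move=> h h' /torus_inner_char[Ah hE] hK.
  have Ah' : is_Kalg_aut h' by apply: (aut_inverse Ah) => a; have [] := hK a.
  apply/torus_inner_char; split=> // i; have [c [c0 cE]] := hE i.
  exists c^-1; split=> [|chi hc]; first by rewrite invr_eq0.
  have [hh' _] := Ah'; have /= := cE _ (hom_comp hc hh').
  by have [_ ->] := hK (x i) => ->; rewrite mulrA mulVf ?mul1r.
- move=> g g' h Ag gK /torus_inner_char[Ah hE].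
  have Ag' : is_Kalg_aut g' by apply: (aut_inverse Ag) => a; have [] := gK a.
  apply/torus_inner_char; split=> [|i]; first exact/aut_comp/Ag'/aut_comp.
  (* On characters [g'] moves [x i] to [d] times [x j], [h] contributes the scalar [c], and [g]
     undoes the move. *)
  have [j [d [d0 dE]]] := aut_char_x i Ag'; have [c [c0 cE]] := hE j.
  have [[hg _] [hh _]] := (Ag, Ah).
  exists c; split=> // chi hc /=.
  have /= -> := dE _ (hom_comp hc (hom_comp hg hh)).
  have /= -> := cE _ (hom_comp hc hg).
  have /= := dE _ (hom_comp hc hg); have [-> _] := gK (x i) => ->.
  by rewrite mulrCA.
Qed.

(** Characters evaluated at [x i] forget the inner factor and determine scalars and permutation; the
    inner factor follows by cancelling the injective maps [tau] and [t]. *)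
Lemma aut_decomposition_unique (tau t w tau' t' w' : A -> A) :
  is_perm_aut x y tau -> is_torus_aut x y t -> is_inner_aut w ->
  is_perm_aut x y tau' -> is_torus_aut x y t' -> is_inner_aut w' ->
  (forall a, tau (t (w a)) = tau' (t' (w' a))) ->
  [/\ forall a, tau a = tau' a, forall a, t a = t' a & forall a, w a = w' a].
Proof.
move=> [[htau btau] [pi piE]] [[ht bt] [l [l0 lE]]] Iw.
move=> [[htau' btau'] [pi' piE']] [[ht' bt'] [l' [l0' lE']]] Iw' E.
have sep i : l i = l' i /\ pi i = pi' i.
  apply: char_sep => // chi hc; have := congr1 chi (E (x i)).
  have /= -> := inner_char (x i) (hom_comp hc (hom_comp htau ht)) Iw.
  have /= -> := inner_char (x i) (hom_comp hc (hom_comp htau' ht')) Iw'.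
  have [-> _] := lE i; have [-> _] := lE' i.
  rewrite (homZ htau) (homZ htau') !(homZ hc).
  by have [-> _] := piE i; have [-> _] := piE' i.
have tauE : forall a, tau a = tau' a.
  apply: hom_unique => // i; have [_ pii] := sep i.
  by have [-> ->] := piE i; have [-> ->] := piE' i; rewrite pii.
have tE : forall a, t a = t' a.
  apply: hom_unique => // i; have [li _] := sep i.
  by have [-> ->] := lE i; have [-> ->] := lE' i; rewrite li.
split=> // a; apply/(bij_inj bt)/(bij_inj btau).
by rewrite E tauE tE.
Qed.

End Representation.

Theorem theorem5p1 (K : fieldType) (n : nat) (A : algType K)
    (x y : 'I_n -> A) :
  [pchar K] =i pred0 -> (1 <= n)%N -> is_S_presentation x y ->
  [/\ is_normal_subgroup_aut (@is_inner_aut K A),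
      is_normal_subgroup_aut (is_torus_inner_aut x y),
      (forall sigma : A -> A, is_Kalg_aut sigma ->
         exists tau t w : A -> A,
           [/\ is_perm_aut x y tau, is_torus_aut x y t, is_inner_aut w
             & forall a, sigma a = tau (t (w a))])
    & (forall tau t w tau' t' w' : A -> A,
         is_perm_aut x y tau -> is_torus_aut x y t -> is_inner_aut w ->
         is_perm_aut x y tau' -> is_torus_aut x y t' -> is_inner_aut w' ->
         (forall a, tau (t (w a)) = tau' (t' (w' a))) ->
         [/\ forall a, tau a = tau' a, forall a, t a = t' a
           & forall a, w a = w' a])].
Proof.
move=> char0 _ presA; have [rep [rep_hom rep_xy]] := presentation_rep presA.
split.
- exact: inner_normal.
- exact: (torus_inner_normal presA rep_hom rep_xy char0).
- exact: (aut_decomposition presA rep_hom rep_xy char0).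
- exact: (aut_decomposition_unique presA char0).
Qed.
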